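(* There exists a closed (in the norm topology) shift invariant subspace $E$ of the Bloch space $\mathcal{B}$ such that $\operatorname{ind}(E) = \operatorname{card}([0,1])$.
   Context: Let $\mathbb{D}=\{z\in\mathbb{C}: |z|<1\}$. The Bloch space $\mathcal{B}$ is the Banach space of functions $f$ analytic in $\mathbb{D}$ with $\sup_{|z|<1}(1-|z|^2)|f'(z)|<+\infty$, with norm $\|f\|_{\mathcal{B}} = |f(0)|+\sup_{|z|<1}(1-|z|^2)|f'(z)|$. The shift operator is $M_z:\mathcal{B}\to\mathcal{B}$, $(M_zf)(z)=zf(z)$; it is bounded and bounded below. A (closed) invariant subspace is a norm-closed linear subspace $E\subset\mathcal{B}$ with $zE:=M_zE\subset E$; then $zE$ is closed and $E/zE$ is a Banach space with the quotient norm. The index of $E$ is $\operatorname{ind}(E)=\dim(E/zE)$, where the dimension of the (infinite-dimensional) quotient is understood topologically, as the least cardinality of a subset of $E/zE$ whose linear span is dense in $E/zE$. *)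

(* Defs.v *)
From HB Require Import structures.
From mathcomp Require Import all_boot all_order all_algebra.
From mathcomp Require Import ring_quotient.
From mathcomp.real_closed Require Import complex.
From mathcomp Require Import all_classical all_reals all_analysis.

Set Implicit Arguments.
Unset Strict Implicit.
Unset Printing Implicit Defensive.

Import Order.TTheory GRing.Theory Num.Theory.
Import numFieldNormedType.Exports.
Import Normc.

Local Open Scope classical_set_scope.
Local Open Scope complex_scope.
Local Open Scope quotient_scope.
Local Open Scope card_scope.
Local Open Scope ring_scope.

Local Notation Re := complex.Re.

Section LinearSpan.
Variables (K : nzRingType) (V : lmodType K).

Definition linear_span (S : set V) : set V :=
  [set v | exists n (c : 'I_n -> K) (s : 'I_n -> V),
     (forall i, S (s i)) /\ v = \sum_(i < n) c i *: s i].

End LinearSpan.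

Section Submodule.
Variables (K : nzRingType) (V : lmodType K) (W : submodClosed V).

Record submod := Submod { submod_val :> V ; _ : submod_val \in W }.

HB.instance Definition _ := [isSub for submod_val].
HB.instance Definition _ := [Choice of submod by <:].
HB.instance Definition _ := [SubChoice_isSubLmodule of submod by <:].

End Submodule.

Section LmodQuotient.
Variables (K : nzRingType) (V : lmodType K) (W : submodClosed V).

Definition submod_pred : {pred V} := [in W].

Fact submod_pred_closed : submod_closed submod_pred.
Proof. exact: (submodClosedP W). Qed.

HB.instance Definition _ :=
  GRing.isSubmodClosed.Build K V submod_pred submod_pred_closed.

Definition lquot := Quotient.quot submod_pred.

HB.instance Definition _ := GRing.Zmodule.on lquot.
HB.instance Definition _ : EqQuotient V (Quotient.equiv submod_pred) lquot :=
  EqQuotient.on lquot.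

Definition lquot_pi (x : V) : lquot := \pi_lquot x.

Definition lquot_scale (a : K) (q : lquot) : lquot := lquot_pi (a *: repr q).

Lemma lquot_piP x y : lquot_pi x = lquot_pi y <-> x - y \in W.
Proof.
rewrite -[x - y \in W]/(x - y \in submod_pred) Quotient.idealrBE.
exact: rwP eqP.
Qed.

Lemma lquot_reprK (q : lquot) : lquot_pi (repr q) = q.
Proof. exact: reprK. Qed.

Lemma lquot_piD x y : lquot_pi (x + y) = lquot_pi x + lquot_pi y.
Proof. exact: Quotient.pi_add. Qed.

Lemma lquot_scaleE a x : lquot_scale a (lquot_pi x) = lquot_pi (a *: x).
Proof.
apply/lquot_piP; rewrite -scalerBr rpredZ//.
by apply/lquot_piP; rewrite lquot_reprK.
Qed.

Let lquot_scaleA a b q :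
  lquot_scale a (lquot_scale b q) = lquot_scale (a * b) q.
Proof. by rewrite -(lquot_reprK q) !lquot_scaleE scalerA. Qed.

Let lquot_scale1 : left_id 1 lquot_scale.
Proof. by move=> q; rewrite -(lquot_reprK q) !lquot_scaleE scale1r. Qed.

Let lquot_scaleDr : right_distributive lquot_scale +%R.
Proof.
move=> a p q; rewrite -(lquot_reprK q) -(lquot_reprK p).
by rewrite !lquot_scaleE -!lquot_piD lquot_scaleE scalerDr.
Qed.

Let lquot_scaleDl q : {morph lquot_scale^~ q : a b / a + b}.
Proof.
by move=> a b; rewrite -(lquot_reprK q) !lquot_scaleE -lquot_piD scalerDl.
Qed.

HB.instance Definition _ := GRing.Zmodule_isLmodule.Build K lquot
  lquot_scaleA lquot_scale1 lquot_scaleDr lquot_scaleDl.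

Lemma lquot_piZ a x : lquot_pi (a *: x) = a *: lquot_pi x.
Proof. by rewrite -lquot_scaleE. Qed.

End LmodQuotient.

(* The complex numbers, packed as a numFieldType so that the normed-module
   structure found on them is the one in the type of derive1. *)
Definition Cplx (R : realType) : numFieldType := R[i].

Section ComplexFacts.
Variable R : realType.
Local Notation C := (Cplx R).

Lemma normcE (z : C) : `|z| = (normc z)%:C.
Proof. by rewrite (@normc_def R z); case: z => a b. Qed.

Lemma normc_ge0 (z : C) : 0 <= normc z.
Proof. by have := normr_ge0 z; rewrite normcE ler0c. Qed.

Lemma normcD (z w : C) : normc (z + w) <= normc z + normc w.
Proof. exact: (@le_normcD R z w). Qed.

Lemma Re_le_normc (z : C) : `|Re z| <= normc z.
Proof. by rewrite -lecR -normcE; exact: (@normc_ge_Re R z). Qed.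

Lemma Re_cvg (T : Type) (F : set_system T) (FF : Filter F) (u : T -> C) (l : C) :
  u @ F --> l -> Re (u x) @[x --> F] --> Re l.
Proof.
move=> /cvgrPdist_lt ul; apply/cvgrPdist_lt => e e0.
have e0' : (0 : C) < e%:C by rewrite ltcR.
have := ul _ e0'; apply: filterS => x.
rewrite normcE ltcR; apply: le_lt_trans.
by rewrite -raddfB; exact: Re_le_normc.
Qed.

Lemma cvg_real_complex0 : (s%:C : C) @[s --> (0 : R)^'] --> (0 : C)^'.
Proof.
move=> A /nbhs_normP[e /= e0 eA].
have e0' : 0 < Re e by move: e0; rewrite ltcE => /andP[].
have eE : e = (Re e)%:C by rewrite RRe_real// gtr0_real.
rewrite /= /nbhs/= /within/=.
apply/nbhs_normP; exists (Re e) => //= s /=; rewrite sub0r normrN => se s0.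
apply: eA => /=; last by apply: contra_neq s0 => /complexI.
rewrite sub0r normrN normcE eE ltcR.
by rewrite /= expr0n/= addr0 sqrtr_sqr.
Qed.

Lemma is_derive_Re_ray (f : C -> C) (c z : C) (t : R) :
  derivable f (t%:C * z) 1 ->
  is_derive t 1 (fun s : R => Re (c * f (s%:C * z)))
    (Re (c * (z * derive1 f (t%:C * z)))).
Proof.
set a : C := t%:C * z => /derivable1_diffP dfa.
have dfz : derivable f a z by exact: diff_derivable.
have Dz : 'D_z f a = z * derive1 f a.
  rewrite deriveE// derive1E'//.
  by rewrite -[in LHS](mulr1 z) -[z * 1]/(z *: (1 : C)) linearZ.
have cvgD : (h^-1 *: (f (h *: z + a) - f a) : C) @[h --> (0 : C)^'] --> 'D_z f a.
  exact: dfz.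
rewrite {}Dz in cvgD.
have /Re_cvg cvgR : (c * (s%:C^-1 * (f ((s + t)%:C * z) - f (t%:C * z))) : C)
    @[s --> (0 : R)^'] --> c * (z * derive1 f a).
  apply: cvgM; first exact: cvg_cst.
  have := cvg_comp _ _ cvg_real_complex0 cvgD.
  apply: cvg_trans; apply: near_eq_cvg; apply: nearW => s /=.
  congr (_ * (f _ - _)); rewrite -[s%:C *: z]/(s%:C * z) /a -mulrDl.
  by congr (_ * z); rewrite /= -!complexr0 /= ; simpc.
have cvgR' : s^-1 *: (Re (c * f ((s *: 1 + t)%:C * z)) - Re (c * f (t%:C * z)))
   @[s --> (0 : R)^'] --> Re (c * (z * derive1 f a)).
  under eq_fun => s.
    rewrite -raddfB -mulrBr [s *: 1]mulr1.
    have -> : s^-1 *: Re (c * (f ((s + t)%:C * z) - f (t%:C * z))) =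
      Re (c * (s%:C^-1 * (f ((s + t)%:C * z) - f (t%:C * z)))).
      rewrite mulrCA -fmorphV; case: (_ * (_ - _)) => x y.
      by rewrite /= mul0r subr0.
    over.
  exact: cvgR.
apply: DeriveDef; first by apply/cvg_ex; eexists; exact: cvgR'.
exact: cvg_lim cvgR'.
Qed.
End ComplexFacts.

Section Disk.
Variable R : realType.
Local Notation C := (Cplx R).

Definition unit_disk : set C := [set z | normc z < 1].

Lemma normc0C : normc (0 : C) = 0.
Proof. exact: normc0. Qed.

Lemma normcMC (z w : C) : normc (z * w) = normc z * normc w.
Proof. exact: normcM. Qed.

Lemma unit_disk0 : unit_disk 0.
Proof. by change (normc (0 : C) < 1); rewrite normc0C ltr01. Qed.

Lemma conjc_mul (d : C) : d^* * d = (normc d ^+ 2)%:C :> C.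
Proof. by rewrite mulrC -sqr_normc [`|d|]normcE rmorphXn. Qed.

Lemma normc_conj (d : C) : normc (d^*) = normc d.
Proof. by case: d => a b; rewrite /= sqrrN. Qed.

Lemma unit_disk_growth (f : C -> C) (z : C) (K : R) :
  (forall w, unit_disk w -> derivable f w 1) -> unit_disk z ->
  (forall w : C, normc w <= normc z -> normc (derive1 f w) <= K) ->
  normc (f z - f 0) <= K * normc z.
Proof.
move=> df z1 f'K.
have K0 : 0 <= K.
  by apply: le_trans (f'K 0 _); rewrite ?normc0C ?normc_ge0.
set d : C := f z - f 0.
have [->|d0] := eqVneq d 0; first by rewrite normc0C mulr_ge0 ?normc_ge0.
have nd0 : 0 < normc d.
  by rewrite lt_neqAle normc_ge0 andbT eq_sym; apply: contra_neq d0 => /eq0_normc.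
have tz (t : R) : t \in `[0, 1] -> normc (t%:C * z : C) <= normc z.
  rewrite in_itv/= => /andP[t0 t1].
  rewrite normcMC/= expr0n/= addr0 sqrtr_sqr ger0_norm//.
  by rewrite ler_piMl ?normc_ge0.
pose h (s : R) := Re ((d^* : C) * f (s%:C * z)).
pose dh (s : R) := Re ((d^* : C) * (z * derive1 f (s%:C * z))).
have hD (t : R) : t \in `[0, 1] ->
    is_derive t 1 h (dh t).
  by move=> /tz t1; apply: is_derive_Re_ray; apply: df; apply: le_lt_trans z1.
have hc : {within `[(0 : R), 1], continuous h}.
  by apply: derivable_within_continuous => x /hD [].
have hD' (x : R) : x \in `]0, 1[%R -> is_derive x 1 h (dh x).
  by move=> x01; apply: hD; apply: subset_itv_oo_cc x01.
have [x x01] := @MVT_segment R h dh 0 1 ler01 hD' hc.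
rewrite /h /dh subr0 mulr1 -raddfB -mulrBr mul1r mul0r -/d conjc_mul /= => h1.
rewrite -(ler_pM2l nd0) -expr2 h1.
apply: le_trans (ler_norm _) _; apply: le_trans (Re_le_normc _) _.
rewrite normcMC (normc_conj d).
rewrite ler_pM2l// normcMC mulrC ler_wpM2r ?normc_ge0//.
by apply: f'K; apply: tz.
Qed.

Lemma derive1D_disk (f g : C -> C) z : derivable f z 1 -> derivable g z 1 ->
  derive1 (f + g) z = derive1 f z + derive1 g z.
Proof. by move=> df dg; rewrite !derive1E deriveD. Qed.

Lemma derive1Z_disk (a : C) (f : C -> C) z : derivable f z 1 ->
  derive1 (a *: f) z = a * derive1 f z.
Proof. by move=> df; rewrite !derive1E deriveZ. Qed.

Lemma derivable_mulz (f : C -> C) z : derivable f z 1 ->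
  derivable (fun w : C => w * f w) z 1.
Proof.
by move=> df; exact: (derivableM (@derivable_id _ _ z 1) df).
Qed.

Lemma derive1_mulz (f : C -> C) z : derivable f z 1 ->
  derive1 (fun w : C => w * f w) z = z * derive1 f z + f z.
Proof.
move=> df; rewrite !derive1E (deriveM (@derivable_id _ _ z 1) df) derive_id.
by congr (_ + _); exact: mulr1.
Qed.

Definition bloch_values (f : C -> C) : set R :=
  [set (1 - normc z ^+ 2) * normc (derive1 f z) | z in unit_disk].

(* A function on the disk is represented by its extension by 0 to the complex
   plane, which makes equality of functions on the disk Leibniz equality. *)
Definition bloch_pred : {pred C -> C} := fun f =>
  `[< [/\ forall z, unit_disk z -> derivable f z 1,
          has_ubound (bloch_values f) &
          forall z, ~ unit_disk z -> f z = 0] >].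

Lemma weight_ge0 (z : C) : unit_disk z -> 0 < 1 - normc z ^+ 2.
Proof. by move=> z1; rewrite subr_gt0 expr_lt1 ?normc_ge0. Qed.

Lemma bloch_growth (f : C -> C) (M : R) (z : C) :
  (forall w, unit_disk w -> derivable f w 1) ->
  ubound (bloch_values f) M -> unit_disk z ->
  (1 - normc z ^+ 2) * normc (f z - f 0) <= M.
Proof.
move=> df fM z1; have wz := weight_ge0 z1.
have M0 : 0 <= M.
  apply: le_trans (fM _ _); last by exists 0; first exact: unit_disk0.
  by rewrite mulr_ge0 ?normc_ge0// ltW// weight_ge0//; exact: unit_disk0.
have : normc (f z - f 0) <= M / (1 - normc z ^+ 2) * normc z.
  apply: unit_disk_growth => // w wlez.
  have w1 : unit_disk w by apply: le_lt_trans z1.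
  rewrite ler_pdivlMr// mulrC; apply: le_trans (fM _ _); last by exists w.
  by rewrite ler_wpM2r ?normc_ge0// lerB// lerXn2r ?nnegrE ?normc_ge0.
rewrite mulrAC ler_pdivlMr// mulrC => /le_trans; apply.
by rewrite ler_piMr// ltW.
Qed.

Lemma bloch_submod_closed : submod_closed bloch_pred.
Proof.
split.
  apply/asboolP; split=> [z _||//]; first exact: derivable_cst.
  exists 0 => _ [z _ <-].
  by rewrite derive1E derive_cst normc0C mulr0.
move=> a f g /asboolP[df [M fM] f0] /asboolP[dg [N gN] g0]; apply/asboolP.
have daf z : unit_disk z -> derivable (a *: f) z 1.
  by move=> z1; apply: derivableZ; exact: df.
split.
- by move=> z z1; apply: derivableD; [exact: daf|exact: dg].
- exists (normc a * M + N) => _ [z z1 <-].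
  rewrite derive1D_disk; [|exact: daf|exact: dg].
  rewrite derive1Z_disk; last exact: df.
  have wz := ltW (weight_ge0 z1).
  apply: le_trans (ler_wpM2l wz (normcD _ _)) _.
  rewrite mulrDr normcMC mulrCA lerD//.
    by rewrite ler_wpM2l ?normc_ge0//; apply: fM; exists z.
  by apply: gN; exists z.
- move=> z z1; rewrite -[(a *: f + g) z]/(a * f z + g z).
  by rewrite f0// g0// mulr0 addr0.
Qed.

HB.instance Definition _ :=
  GRing.isSubmodClosed.Build C (C -> C) bloch_pred bloch_submod_closed.

Record bloch := Bloch { bloch_fun :> C -> C ; _ : bloch_fun \in bloch_pred }.

HB.instance Definition _ := [isSub for bloch_fun].
HB.instance Definition _ := [Choice of bloch by <:].
HB.instance Definition _ := [SubChoice_isSubLmodule of bloch by <:].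

Definition bloch_norm (f : bloch) : R := normc (f 0) + sup (bloch_values f).

Lemma blochP (f : bloch) :
  [/\ forall z, unit_disk z -> derivable f z 1,
      has_ubound (bloch_values f) & forall z, ~ unit_disk z -> f z = 0].
Proof. by case: f => f fP /=; exact/asboolP. Qed.

Lemma bloch_ext (f g : bloch) : f =1 g -> f = g.
Proof. by move=> fg; apply: val_inj; apply/funext. Qed.

Lemma bloch_has_sup (f : bloch) : has_sup (bloch_values f).
Proof.
split; last by case: (blochP f).
by eexists; exists 0; first exact: unit_disk0.
Qed.

Lemma bloch_valueD (f g : bloch) z : unit_disk z ->
  normc (derive1 (f + g : bloch) z) <= normc (derive1 f z) + normc (derive1 g z).
Proof.
move=> z1; case: (blochP f) => df _ _; case: (blochP g) => dg _ _.
by rewrite -[bloch_fun (f + g)]/(f + g : C -> C) derive1D_disk ?normcD//;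
  [exact: df|exact: dg].
Qed.

Lemma bloch_valueZ a (f : bloch) z : unit_disk z ->
  normc (derive1 (a *: f : bloch) z) = normc a * normc (derive1 f z).
Proof.
move=> z1; case: (blochP f) => df _ _.
by rewrite -[bloch_fun (a *: f)]/(a *: (f : C -> C)) derive1Z_disk ?normcMC//;
  exact: df.
Qed.

Lemma bloch_sup_ub (f : bloch) z : unit_disk z ->
  (1 - normc z ^+ 2) * normc (derive1 f z) <= sup (bloch_values f).
Proof. by move=> z1; apply: sup_upper_bound; [exact: bloch_has_sup|exists z]. Qed.

Lemma bloch_sup_le (f : bloch) M :
  (forall z, unit_disk z -> (1 - normc z ^+ 2) * normc (derive1 f z) <= M) ->
  sup (bloch_values f) <= M.
Proof.
by move=> fM; apply: ge_sup; [case: (bloch_has_sup f)|move=> _ [z z1 <-]; exact: fM].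
Qed.

Lemma bloch_sup_ge0 (f : bloch) : 0 <= sup (bloch_values f).
Proof.
apply: le_trans (bloch_sup_ub f unit_disk0).
by rewrite mulr_ge0 ?normc_ge0// ltW// weight_ge0//; exact: unit_disk0.
Qed.

(* Over Cplx R, norms take their values in Cplx R. *)
Let normD (f g : bloch) :
  (bloch_norm (f + g))%:C <= (bloch_norm f)%:C + (bloch_norm g)%:C.
Proof.
rewrite -rmorphD lecR /bloch_norm addrACA lerD//; first exact: normcD.
apply: bloch_sup_le => z z1; have wz := ltW (weight_ge0 z1).
apply: le_trans (ler_wpM2l wz (bloch_valueD f g z1)) _.
by rewrite mulrDr lerD// bloch_sup_ub.
Qed.

Let normZ_le (a : C) (f : bloch) : bloch_norm (a *: f) <= normc a * bloch_norm f.
Proof.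
rewrite /bloch_norm mulrDr -[(a *: f : bloch) 0]/(a * f 0) normcMC lerD2l.
apply: bloch_sup_le => z z1; rewrite bloch_valueZ// mulrCA.
by rewrite ler_wpM2l ?normc_ge0// bloch_sup_ub.
Qed.

Let normZ (a : C) (f : bloch) :
  (bloch_norm (a *: f))%:C = `|a| * (bloch_norm f)%:C.
Proof.
rewrite [`|a|]normcE -rmorphM; congr (_%:C).
apply/eqP; rewrite eq_le normZ_le/=.
have [->|a0] := eqVneq a 0.
  by rewrite normc0C mul0r addr_ge0 ?normc_ge0 ?bloch_sup_ge0.
have na0 : 0 < normc a.
  by rewrite lt_neqAle normc_ge0 andbT eq_sym; apply: contra_neq a0 => /eq0_normc.
rewrite -ler_pdivlMl// -normcV.
by rewrite -{1}[f](scalerK a0); exact: normZ_le.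
Qed.

Let norm0_eq0 (f : bloch) : (bloch_norm f)%:C = 0 :> C -> f = 0.
Proof.
move=> /complexI/eqP; rewrite paddr_eq0 ?normc_ge0 ?bloch_sup_ge0//.
move=> /andP[/eqP/eq0_normc f0 /eqP s0]; apply: bloch_ext => z.
case: (blochP f) => df _ fout.
have [z1|/fout//] := pselect (unit_disk z).
have fM : ubound (bloch_values f) 0.
  by rewrite -s0; apply: sup_upper_bound; exact: bloch_has_sup.
have := bloch_growth df fM z1.
rewrite f0 subr0 pmulr_rle0 ?weight_ge0// => fz0.
by apply: eq0_normc; apply/le_anti; rewrite fz0 normc_ge0.
Qed.

HB.instance Definition _ :=
  Lmodule_isNormed.Build C bloch normD normZ norm0_eq0.

Lemma bloch_normE (f : bloch) : `|f| = (bloch_norm f)%:C.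
Proof. by []. Qed.

Fact bloch_shift_subproof (f : bloch) : (fun z => z * f z) \in bloch_pred.
Proof.
case: (blochP f) => df [M fM] fout; apply/asboolP; split.
- by move=> z /df/derivable_mulz.
- exists (M + (normc (f 0) + M)) => _ [z z1 <-].
  have wz := ltW (weight_ge0 z1).
  rewrite derive1_mulz; last exact: df.
  apply: le_trans (ler_wpM2l wz (normcD _ _)) _; rewrite mulrDr lerD//.
    apply: le_trans (fM _ _); last by exists z.
    by rewrite ler_wpM2l// normcMC ler_piMl ?normc_ge0// ltW.
  have -> : f z = f 0 + (f z - f 0) by rewrite addrCA subrr addr0.
  apply: le_trans (ler_wpM2l wz (normcD _ _)) _; rewrite mulrDr lerD//.
    by rewrite ler_piMl ?normc_ge0// gerBl exprn_ge0 ?normc_ge0.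
  exact: bloch_growth.
- by move=> z /fout ->; rewrite mulr0.
Qed.

Definition bloch_shift (f : bloch) : bloch := Bloch (bloch_shift_subproof f).

End Disk.

Section Index.
Variable R : realType.
Local Notation C := (Cplx R).

Lemma bloch_shiftD (f g : bloch R) :
  bloch_shift (f + g) = bloch_shift f + bloch_shift g.
Proof. by apply: bloch_ext => z /=; exact: mulrDr. Qed.

Lemma bloch_shiftZ (a : C) (f : bloch R) :
  bloch_shift (a *: f) = a *: bloch_shift f.
Proof. by apply: bloch_ext => z /=; exact: mulrCA. Qed.

Variable E : submodClosed (bloch R).

(* zE, as a subspace of E: for E invariant, bloch_shift maps E into E. *)
Definition shift_image : {pred submod E} := fun g =>
  `[< exists2 f : bloch R, f \in E & submod_val g = bloch_shift f >].

Fact shift_image_closed : submod_closed shift_image.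
Proof.
split.
  apply/asboolP; exists 0; first exact: rpred0.
  by apply: bloch_ext => z; rewrite /= mulr0.
move=> a g1 g2 /asboolP[f1 f1E g1E] /asboolP[f2 f2E g2E].
apply/asboolP; exists (a *: f1 + f2); first by rewrite rpredD ?rpredZ.
by rewrite bloch_shiftD bloch_shiftZ -g1E -g2E.
Qed.

HB.instance Definition _ :=
  GRing.isSubmodClosed.Build C (submod E) shift_image shift_image_closed.

Definition shift_quot := lquot shift_image.

Definition quot_norm (q : shift_quot) : R :=
  inf [set bloch_norm (submod_val f) | f in [set f : submod E | lquot_pi _ f = q]].

Definition dense_span (S : set shift_quot) : Prop :=
  forall (q : shift_quot) (e : R), 0 < e ->
    exists2 s, linear_span S s & quot_norm (q - s) < e.

(* ind(E) = card(A): the least cardinality of a set with dense span in E/zE is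
   attained, and it is that of A. *)
Definition index_eq_card (T : Type) (A : set T) : Prop :=
  (exists S, dense_span S /\ S #= A) /\ (forall S, dense_span S -> A #<= S).

End Index.

(* Main.v *)
(** For a set [A] of exponents put [f_A = \sum_(k in A) z^(M_k)] with
    [M_k = 2^k k!].  On the circle of radius [1 - 1/(2 M_k)] the term of exponent
    [M_k] contributes at least [1/4] to [(1 - |z|) |f_A'|], and all the other
    terms together contribute [O(1/k)].  Let [A_x], for [x] in the Cantor space,
    be a family of infinite, pairwise almost disjoint sets of exponents, and let
    [E] be the closed span of the [z^n f_(A_x)].  For finitely many indices there
    are circles on which only a prescribed one of the [f_(A_x)'] is not small, and
    on such a circle a polynomial with constant term [1] is somewhere of modulus
    at least [1].  Hence the distance from [f_(A_t)] to the closed span [H_t] of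
    all the generators other than [f_(A_t)] itself is at least [1/8].  Since [zE]
    is contained in [H_t], a set with dense span in [E/zE] has, for every [t], an
    element outside [H_t]; but an element of [E] is outside [H_t] for only
    countably many [t], so the set has the cardinality of the continuum. *)
From HB Require Import structures.
Require Import Defs.
From mathcomp Require Import all_boot all_order all_algebra.
From mathcomp.real_closed Require Import complex.
From mathcomp Require Import all_classical all_reals all_analysis.
From mathcomp Require Import zify ring lra.

Set Implicit Arguments.
Unset Strict Implicit.
Unset Printing Implicit Defensive.

Import Order.TTheory GRing.Theory Num.Theory.
Import numFieldNormedType.Exports.
Import Normc.

Local Open Scope classical_set_scope.
Local Open Scope complex_scope.
Local Open Scope card_scope.
Local Open Scope ring_scope.

(** * Elementary inequalities for powers of a number in [0, 1] *)

Section PowerBounds.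
Variable R : realFieldType.
Implicit Types (r u : R).

Lemma bernoulli_le u n : 0 <= u <= 1 -> 1 - n%:R * u <= (1 - u) ^+ n.
Proof.
move=> /andP[u0 u1]; elim: n => [|n IHn]; first by rewrite mul0r subr0.
rewrite exprS -natr1; apply: le_trans (ler_wpM2l _ IHn); last by rewrite subr_ge0.
have : 0 <= n%:R * (u * u) by rewrite !mulr_ge0.
by lra.
Qed.

Lemma bernoulli_inv u n : 0 <= u <= 1 -> (1 - u) ^+ n * (1 + n%:R * u) <= 1.
Proof.
move=> /andP[u0 u1]; elim: n => [|n IHn]; first by rewrite mul0r addr0 mulr1.
apply: le_trans IHn; rewrite exprSr -mulrA ler_wpM2l ?exprn_ge0 ?subr_ge0//.
rewrite -natr1; have : 0 <= n%:R * (u * u) by rewrite !mulr_ge0.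
have : 0 <= u * u by rewrite mulr_ge0.
by lra.
Qed.

(** Each of the [n] terms of 1 + r + ... + r^(n-1) is at least r^(n-1). *)
Lemma geometric_diff r n : 0 <= r <= 1 ->
  (1 - r) * (n%:R * r ^+ n.-1) <= 1 - r ^+ n.
Proof.
move=> /andP[r0 r1]; elim: n => [|[|n] IHn].
- by rewrite mul0r mulr0 subrr.
- by rewrite mul1r mulr1.
rewrite /= in IHn *; rewrite -natr1 [(_ + 1) * _]mulrDl mul1r mulrDr.
have -> : 1 - r ^+ n.+2 = 1 - r ^+ n.+1 + (1 - r) * r ^+ n.+1.
  by rewrite (exprS r n.+1); ring.
rewrite lerD2r; apply: le_trans IHn; rewrite ler_wpM2l ?subr_ge0//.
by rewrite ler_wpM2l// exprS ler_piMl// exprn_ge0.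
Qed.

(** Replaces a term of a differentiated series by a difference of powers, so that sums over lacunary
    exponents telescope. After factoring out [r ^+ m] this is [geometric_diff] for [n - m], and the
    factor 2 comes from n <= 2 (n - m). *)
Lemma power_gap r m n : 0 <= r <= 1 -> (2 * m <= n)%N ->
  (1 - r) * (n%:R * r ^+ n.-1) <= 2 * (r ^+ m - r ^+ n).
Proof.
move=> r01; have /andP[r0 r1] := r01; case: n => [|n] mn.
  by move: mn; rewrite leqn0 muln_eq0/= => /eqP->; rewrite mul0r mulr0 subrr mulr0.
have [d nE] : exists d, n = (m + d)%N by exists (n - m)%N; lia.
rewrite /= nE -addnS !exprD -[X in 2 * (X - _)]mulr1 -mulrBr.
have -> : (1 - r) * ((m + d.+1)%:R * (r ^+ m * r ^+ d)) =
  r ^+ m * ((1 - r) * ((m + d.+1)%:R * r ^+ d)) by ring.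
rewrite [leRHS]mulrCA; apply: ler_wpM2l; first exact: exprn_ge0.
apply: le_trans (ler_wpM2l _ (geometric_diff d.+1 r01)) => //=.
rewrite [leRHS]mulrCA ler_wpM2l ?subr_ge0// mulrA ler_wpM2r ?exprn_ge0//.
by rewrite -natrM ler_nat; lia.
Qed.

End PowerBounds.

(** * Lacunary exponents and the dominant term on a circle *)

Section Lacunary.
Variable R : realFieldType.
Implicit Types (r : R).

(** Consecutive exponents have ratio [2 * n.+1]. That it is at least 2 gives a Bloch function; that
    it tends to infinity makes the other terms negligible on the circle belonging to one term. *)
Definition lac n := (2 ^ n * n`!)%N.

Lemma lacS n : lac n.+1 = (2 * n.+1 * lac n)%N.
Proof. by rewrite /lac expnS factS; lia. Qed.

Lemma lac_gt n : (n < lac n)%N.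
Proof.
elim: n => // n IHn; rewrite lacS -mulnA.
have : (n.+1 * 1 <= n.+1 * lac n)%N by rewrite leq_mul// (leq_ltn_trans _ IHn).
by lia.
Qed.

Lemma lac_double n : (2 * lac n <= lac n.+1)%N.
Proof. by rewrite lacS -mulnA leq_mul// leq_pmull. Qed.

Lemma lac_head k : (k * (\sum_(j < k) lac j) <= lac k)%N.
Proof.
elim: k => [|[|k] IHk] //; first by rewrite big_ord_recr big_ord0.
rewrite big_ord_recr [lac k.+2]lacS /=.
move: IHk; set S := (\sum_(j < k.+1) _)%N; set L := lac _ => IHk.
have : (S <= L)%N by apply: leq_trans IHk; rewrite leq_pmull.
by rewrite -mulnA mulnCA leq_mul2l /=; lia.
Qed.

Definition lac_term r n : R := (lac n)%:R * r ^+ (lac n).-1.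

Lemma lac_term_ge0 r n : 0 <= r -> 0 <= lac_term r n.
Proof. by move=> r0; rewrite mulr_ge0// exprn_ge0. Qed.

(** By [power_gap] the first term costs at most 2 (r^m - r^(lac p)); the induction continues with
    [lac p] in place of [m], and the bounds telescope. *)
Lemma lac_tail r m p N : 0 <= r <= 1 -> (2 * m <= lac p)%N ->
  (1 - r) * (\sum_(i < N) lac_term r (p + i)) <= 2 * r ^+ m.
Proof.
move=> r01; have /andP[r0 r1] := r01.
elim: N p m => [|N IHN] p m mp.
  by rewrite big_ord0 mulr0 mulr_ge0 ?exprn_ge0.
rewrite big_ord_recl addn0 mulrDr.
under eq_bigr do rewrite /= /bump /= addnCA add1n -addSn.
have := power_gap r01 mp; rewrite -/(lac_term r p).
have := IHN p.+1 _ (lac_double p).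
by lra.
Qed.

Lemma lac_sum_le r N : 0 <= r <= 1 -> (1 - r) * (\sum_(i < N) lac_term r i) <= 2.
Proof. by move=> r01; have := @lac_tail r 0 0 N r01 isT; rewrite expr0 mulr1. Qed.

Definition lac_gap k : R := (2 * (lac k)%:R)^-1.

Lemma lac_gap_gt0 k : 0 < lac_gap k.
Proof. by rewrite invr_gt0 mulr_gt0// ltr0n (leq_ltn_trans _ (lac_gt k)). Qed.

Lemma lac_gapE k : (lac k)%:R * lac_gap k = 2^-1.
Proof.
rewrite /lac_gap invfM mulrCA divff ?mulr1// pnatr_eq0 -lt0n.
exact: leq_ltn_trans (lac_gt k).
Qed.

Lemma lac_gap_le k : lac_gap k <= k.+1%:R^-1.
Proof.
have := lac_gt k => h.
by rewrite lef_pV2 ?posrE// -?natrM ?ltr0n ?ler_nat; lia.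
Qed.

Lemma lac_gap_le1 k : lac_gap k <= 1.
Proof. by apply: le_trans (lac_gap_le k) _; rewrite invf_le1 ?ler1n. Qed.

(** The exponent times the gap is 1/2, and by Bernoulli's inequality the power is still at least
    1/2. *)
Lemma lac_main k : 4^-1 <= lac_gap k * lac_term (1 - lac_gap k) k.
Proof.
have u0 := lac_gap_gt0 k; have u1 := lac_gap_le1 k.
rewrite /lac_term mulrA [lac_gap k * _]mulrC lac_gapE.
have : 1 - (lac k).-1%:R * lac_gap k <= (1 - lac_gap k) ^+ (lac k).-1.
  by apply: bernoulli_le; rewrite ltW.
have : (lac k).-1%:R * lac_gap k <= 2^-1.
  by rewrite -(lac_gapE k) ler_wpM2r ?ler_nat ?ltW// leq_pred.
by lra.
Qed.

(** The head contributes 1/(k+1), by [lac_head] with the powers bounded by 1. The tail contributes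
    4/(k+1): [lac_tail] applies with m = (k+1) [lac k], and r^m <= 1/(1 + (k+1)/2) by
    [bernoulli_inv]. *)
Lemma lac_off k N :
  lac_gap k * (\sum_(j < N | j != k :> nat) lac_term (1 - lac_gap k) j) <= 5 / k.+1%:R.
Proof.
set u := lac_gap k; set r := 1 - u.
have u0 : 0 < u := lac_gap_gt0 k; have u1 : u <= 1 := lac_gap_le1 k.
have r01 : 0 <= r <= 1 by rewrite /r; lra.
have uE : u = 1 - r by rewrite /r; lra.
have /andP[r0 r1] := r01.
have k0 : 0 < k.+1%:R :> R by rewrite ltr0n.
(* As [N] may be at most [k], the sum is first enlarged to the indices below [k.+1 + N] and then
   split at [k]. *)
have sumN : \sum_(j < N | j != k :> nat) lac_term r j <=
    \sum_(j < k) lac_term r j + \sum_(i < N) lac_term r (k.+1 + i).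
  rewrite -(big_mkord (fun j => j != k) (lac_term r)).
  apply: (@le_trans _ _ (\sum_(0 <= j < k.+1 + N | j != k) lac_term r j)).
    rewrite (@big_cat_nat _ _ _ N 0 (k.+1 + N))//= ?leq_addl// lerDl.
    by apply: sumr_ge0 => j _; exact: lac_term_ge0.
  rewrite (@big_cat_nat _ _ _ k.+1 0 (k.+1 + N))//= ?leq_addr// lerD//.
    rewrite big_mkcond big_nat_recr//= eqxx/= addr0 big_mkord.
    by apply: ler_sum => j _; case: ifP => // _; exact: lac_term_ge0.
  rewrite -[X in index_iota X]add0n big_addn addKn big_mkcond big_mkord.
  apply: ler_sum => i _; rewrite [(i + _)%N]addnC.
  by case: ifP => // _; exact: lac_term_ge0.
apply: le_trans (ler_wpM2l (ltW u0) sumN) _; rewrite mulrDr.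
have head : u * (\sum_(j < k) lac_term r j) <= k.+1%:R^-1.
  have hS : \sum_(j < k) lac_term r j <= (\sum_(j < k) lac j)%:R.
    rewrite natr_sum; apply: ler_sum => j _.
    by rewrite /lac_term ler_piMr// exprn_ile1.
  apply: le_trans (ler_wpM2l (ltW u0) hS) _.
  have := lac_head k; set S := (\sum_(j < k) lac j)%N => hk.
  have hk' : (k.+1 * S <= 2 * lac k)%N.
    have [k1|k1] := posnP k; last by nia.
    have -> : S = 0%N by rewrite /S k1 big_ord0.
    by rewrite muln0.
  have L0 : 0 < 2 * (lac k)%:R :> R by
    rewrite mulr_gt0// ltr0n (leq_ltn_trans _ (lac_gt k)).
  rewrite /u /lac_gap mulrC ler_pdivrMr// -ler_pdivrMl ?invr_gt0// invrK.
  by rewrite -!natrM ler_nat.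
have tail : u * (\sum_(i < N) lac_term r (k.+1 + i)) <= 4 / k.+1%:R.
  rewrite uE; apply: le_trans (@lac_tail r (k.+1 * lac k) _ _ r01 _) _.
    by rewrite lacS mulnA.
  have : r ^+ (k.+1 * lac k) * (1 + (k.+1 * lac k)%:R * u) <= 1.
    by apply: bernoulli_inv; rewrite ltW.
  rewrite natrM -mulrA lac_gapE ler_pdivlMr//.
  have : 0 <= r ^+ (k.+1 * lac k) by rewrite exprn_ge0.
  set x := r ^+ _; set y : R := k.+1%:R; rewrite mulrDr mulr1; lra.
have -> : 5 / k.+1%:R = k.+1%:R^-1 + 4 / k.+1%:R :> R by ring.
exact: lerD.
Qed.

End Lacunary.

(** * Complex series and second-order remainders *)

Lemma second_order_step (K : comNzRingType) (z h : K) n :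
  (z + h) ^+ n.+2 - z ^+ n.+2 - h * (n.+2%:R * z ^+ n.+1) =
  (z + h) * ((z + h) ^+ n.+1 - z ^+ n.+1 - h * (n.+1%:R * z ^+ n)) +
  h ^+ 2 * (n.+1%:R * z ^+ n).
Proof.
rewrite -[n.+2%:R]natr1 !exprS expr0.
by move: ((z + h) ^+ n) (z ^+ n) (n.+1%:R : K) => x y c; ring.
Qed.

Section ComplexSums.
Variable R : realType.
Local Notation C := (Cplx R).
Implicit Types (z w h : C) (a : nat -> C).

Lemma normcB z w : normc (z - w) <= normc z + normc w.
Proof. by apply: le_trans (normcD _ _) _; rewrite normcN. Qed.

Lemma normc_nat n : normc (n%:R : C) = n%:R.
Proof.
have -> : (n%:R : C) = (n%:R : R)%:C by symmetry; exact: (rmorph_nat (real_complex R)).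
by rewrite /= expr0n /= addr0 sqrtr_sqr ger0_norm.
Qed.

Lemma normcX z n : normc (z ^+ n) = normc z ^+ n.
Proof.
elim: n => [|n IHn]; first by rewrite !expr0; exact: (normc_nat 1).
by rewrite !exprS normcMC IHn.
Qed.

Lemma normc_sum (I : Type) (s : seq I) (P : pred I) (F : I -> C) :
  normc (\sum_(i <- s | P i) F i) <= \sum_(i <- s | P i) normc (F i).
Proof.
apply: (big_ind2 (fun (x : C) y => normc x <= y)) => //.
  by rewrite normc0C.
by move=> x y x' y' h1 h2; apply: le_trans (normcD _ _) _; exact: lerD.
Qed.

Lemma Im_le_normc z : `|complex.Im z| <= normc z.
Proof.
by case: z => x y /=; rewrite -sqrtr_sqr ler_sqrt ?lerDr ?addr_ge0 ?sqr_ge0.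
Qed.

Lemma normc_le_ReIm z : normc z <= `|complex.Re z| + `|complex.Im z|.
Proof.
case: z => x y /=; rewrite -[leRHS]ger0_norm ?addr_ge0// -sqrtr_sqr.
rewrite ler_sqrt ?sqr_ge0// sqrrD !real_normK ?num_real//.
by rewrite addrAC lerDl mulrn_wge0// mulr_ge0.
Qed.

Lemma cvg_complex (T : Type) (F : set_system T) (FF : Filter F) (u : T -> C) (x y : R) :
  complex.Re (u t) @[t --> F] --> x -> complex.Im (u t) @[t --> F] --> y ->
  u @ F --> (x +i* y : C).
Proof.
move=> /cvgrPdist_lt ux /cvgrPdist_lt uy; apply/cvgrPdist_lt => e e0.
have re0 : 0 < complex.Re e by move: e0; rewrite ltcE => /andP[].
have eE : e = (complex.Re e)%:C by rewrite RRe_real// gtr0_real.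
have he : 0 < complex.Re e / 2 by rewrite divr_gt0.
near=> t; rewrite Defs.normcE eE ltcR; apply: le_lt_trans (normc_le_ReIm _) _.
rewrite [ltRHS]splitr ltrD//.
  by rewrite raddfB /=; near: t; exact: ux.
by rewrite raddfB /=; near: t; exact: uy.
Unshelve. all: by end_near. Qed.

Lemma normc_lim_le (u : nat -> C) (l : C) (B : R) : u @ \oo --> l ->
  (\forall n \near \oo, normc (u n) <= B) -> normc l <= B.
Proof.
move=> /cvgrPdist_lt ul uB; apply/ler_addgt0Pr => e e0.
have e0' : (0 : C) < e%:C by rewrite ltcR.
have [n []] := filter_ex (filterI uB (ul _ e0')).
move=> un; rewrite Defs.normcE ltcR => lun.
have -> : l = u n + (l - u n) by rewrite addrCA subrr addr0.
by apply: le_trans (normcD _ _) _; rewrite lerD// ltW.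
Qed.

(** Summing real and imaginary parts separately reduces convergence to that of absolutely convergent
    real series. *)
Definition csum a : C :=
  limn (series (fun j => complex.Re (a j))) +i* limn (series (fun j => complex.Im (a j))).

Definition csummable a := exists B, forall N, \sum_(j < N) normc (a j) <= B.

Lemma csum_cvg a : csummable a -> series a @ \oo --> csum a.
Proof.
move=> [B aB].
have cvg_part (f : C -> R) : (forall z, `|f z| <= normc z) ->
    cvgn (series (fun j => f (a j))).
  move=> fle; apply: normed_cvg; apply: nondecreasing_is_cvgn.
    apply/nondecreasing_seqP => n.
    by rewrite /normed_series_of seriesSr lerDl normr_ge0.
  exists B => _ [n _ <-]; apply: le_trans (aB n); rewrite /normed_series_of.
  by rewrite seriesEord; apply: ler_sum => j _; exact: fle.
apply: cvg_complex.
  under eq_fun do rewrite raddf_sum.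
  exact: (cvg_part (@complex.Re R) (@Re_le_normc R)).
under eq_fun do rewrite raddf_sum.
exact: (cvg_part (@complex.Im R) Im_le_normc).
Qed.

Lemma csummable_le a (b : nat -> R) B : (forall j, normc (a j) <= b j) ->
  (forall N, \sum_(j < N) b j <= B) -> csummable a.
Proof. by move=> ab bB; exists B => N; apply: le_trans (bB N); exact: ler_sum. Qed.

Lemma csum_le a (b : nat -> R) B : (forall j, normc (a j) <= b j) ->
  (forall N, \sum_(j < N) b j <= B) -> normc (csum a) <= B.
Proof.
move=> ab bB; apply: (normc_lim_le (csum_cvg (csummable_le ab bB))).
apply: nearW => n; apply: le_trans (bB n); rewrite seriesEord.
by apply: le_trans (normc_sum _ _ _) _; exact: ler_sum.
Qed.

Lemma csum_off a (b : nat -> R) B k : (forall j, normc (a j) <= b j) ->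
  (forall N, \sum_(j < N | j != k :> nat) b j <= B) ->
  normc (csum a - a k) <= B.
Proof.
move=> ab bB.
have b0 j : 0 <= b j by apply: le_trans (ab j); exact: normc_ge0.
(* The hypothesis bounds partial sums without the index [k]; adding [b k] bounds the full ones. *)
have sa : csummable a.
  apply: (@csummable_le _ b (b k + B)) => // N.
  have [kN|Nk] := ltnP k N.
    by rewrite (bigD1 (Ordinal kN))//= lerD2l; exact: bB.
  apply: le_trans (_ : B <= _); last by rewrite lerDr.
  apply: le_trans (bB N); rewrite le_eqVlt; apply/orP; left; apply/eqP.
  by apply: eq_bigl => j; rewrite neq_ltn (leq_trans (ltn_ord j) Nk).
apply: (normc_lim_le (cvgB (csum_cvg sa) (cvg_cst (a k)))).
exists k.+1 => // n /= kn; rewrite !fctE seriesEord /= (bigD1 (Ordinal kn))//=.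
rewrite addrAC subrr add0r; apply: le_trans (normc_sum _ _ _) _.
by apply: le_trans (bB n); exact: ler_sum.
Qed.

(** The induction closes because (n+1)^2 + (n+1) <= (n+2)^2. The factor [s] on the left leaves the
    exponent [n.-1] on the right; for s = t^2 the last factor is then the square of n t^(n-1), a
    squared [lac_term]. *)
Lemma power_second_order z h (s : R) n :
  0 < s -> normc z <= s -> normc (z + h) <= s ->
  s * normc ((z + h) ^+ n - z ^+ n - h * (n%:R * z ^+ n.-1)) <=
  normc h ^+ 2 * (n%:R ^+ 2 * s ^+ n.-1).
Proof.
move=> s0 zs zhs; case: n => [|n].
  by rewrite !expr0 subrr mul0r mulr0 subr0 normc0C mulr0 expr0n mul0r mulr0.
elim: n => [|n]; rewrite /=.
  have -> : (z + h) ^+ 1 - z ^+ 1 - h * (1%:R * z ^+ 0) = 0.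
    by rewrite !expr1 expr0; ring.
  by rewrite normc0C mulr0 expr0 !mulr1 expr1n mulr1 exprn_ge0 ?normc_ge0.
set e := _ - _ - h * (_ * z ^+ n) => IHn.
rewrite second_order_step -/e.
apply: le_trans (ler_wpM2l (ltW s0) (normcD _ _)) _.
rewrite mulrDr !normcMC normc_nat !normcX.
have h1 : s * (normc (z + h) * normc e) <= s * (normc h ^+ 2 * (n.+1%:R ^+ 2 * s ^+ n)).
  rewrite mulrCA; apply: ler_pM => //; first exact: normc_ge0.
  by rewrite mulr_ge0 ?normc_ge0// ltW.
have h2 : s * (normc h ^+ 2 * (n.+1%:R * normc z ^+ n)) <=
    s * (normc h ^+ 2 * (n.+1%:R * s ^+ n)).
  apply: ler_wpM2l; first exact: ltW.
  apply: ler_wpM2l; first by rewrite exprn_ge0 ?normc_ge0.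
  by apply: ler_wpM2l => //; apply: lerXn2r => //; rewrite nnegrE ?normc_ge0 ?ltW.
apply: le_trans (lerD h1 h2) _.
have ident (x y c : R) :
    s * (x * (c ^+ 2 * y)) + s * (x * (c * y)) = x * ((c ^+ 2 + c) * (s * y)) by ring.
rewrite ident -exprS.
apply: ler_wpM2l; first by rewrite exprn_ge0 ?normc_ge0.
apply: ler_wpM2r; first by rewrite exprn_ge0 ?ltW.
rewrite -[n.+2%:R]natr1; have : 0 <= n.+1%:R :> R by [].
by move: (n.+1%:R : R) => x x0; nra.
Qed.

Lemma is_derive_second_order (f : C -> C) z (g : C) (d K : R) : 0 < d ->
  (forall h, normc h < d -> normc (f (z + h) - f z - h * g) <= K * normc h ^+ 2) ->
  is_derive z 1 f g.
Proof.
move=> d0 fK.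
have lim : h^-1 *: (f (h *: 1 + z) - f z) @[h --> (0 : C)^'] --> g.
  apply/cvgrPdist_lt => e e0.
  have re0 : 0 < complex.Re e by move: e0; rewrite ltcE => /andP[].
  have eE : e = (complex.Re e)%:C by rewrite RRe_real// gtr0_real.
  have K1 : 0 < `|K| + 1 by rewrite ltr_wpDl.
  pose m := Num.min d (complex.Re e / (`|K| + 1)).
  have m0 : 0 < m by rewrite lt_min d0 divr_gt0.
  have m0' : (0 : C) < m%:C by rewrite ltcR.
  apply/nbhs_normP; exists m%:C => //= h /=; rewrite sub0r normrN Defs.normcE ltcR.
  rewrite lt_min => /andP[hd hm] h0.
  have nh0 : 0 < normc h.
    by rewrite lt_neqAle normc_ge0 andbT eq_sym; apply: contra_neq h0 => /eq0_normc.
  rewrite Defs.normcE eE ltcR -(ltr_pM2l nh0) -normcMC.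
  have -> : h * (g - h^-1 *: (f (h *: 1 + z) - f z)) = - (f (z + h) - f z - h * g).
    rewrite -[h *: 1]/(h * 1) mulr1 -[h^-1 *: _]/(h^-1 * _) mulrBr mulVKf//.
    by rewrite [in RHS]opprB [h + z]addrC.
  rewrite normcN; apply: le_lt_trans (fK _ hd) _.
  rewrite expr2 mulrCA ltr_pM2l//.
  apply: le_lt_trans (_ : (`|K| + 1) * normc h < _).
    by rewrite ler_wpM2r ?normc_ge0// (le_trans (ler_norm _))// lerDl.
  by rewrite mulrC -ltr_pdivlMr.
by apply: DeriveDef; [apply/cvg_ex; exists g|exact: cvg_lim lim].
Qed.

End ComplexSums.

(** * Lacunary series as Bloch functions *)

Section LacunaryFunctions.
Variable R : realType.
Local Notation C := (Cplx R).
Implicit Types (z w h : C) (A : nat -> bool).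

Definition lac_fun A z : C := csum (fun j => (A j)%:R * z ^+ lac j).

Definition lac_deriv A z : C :=
  csum (fun j => (A j)%:R * ((lac j)%:R * z ^+ (lac j).-1)).

Lemma normc_bool_le (b : bool) z : normc (b%:R * z) <= normc z.
Proof. by case: b; rewrite ?mul1r// mul0r normc0C normc_ge0. Qed.

Lemma lac_deriv_term_le A z (s : R) j : normc z <= s ->
  normc ((A j)%:R * ((lac j)%:R * z ^+ (lac j).-1)) <= lac_term s j.
Proof.
move=> zs; apply: le_trans (normc_bool_le _ _) _.
rewrite normcMC normc_nat normcX ler_wpM2l// lerXn2r ?nnegrE ?normc_ge0//.
by apply: le_trans zs; exact: normc_ge0.
Qed.

(** The exponents are at least 1, so the majorant of the differentiated series also serves for the
    series itself. *)
Lemma lac_fun_term_le A z (s : R) j : normc z <= s -> s <= 1 ->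
  normc ((A j)%:R * z ^+ lac j) <= lac_term s j.
Proof.
move=> zs s1; have z0 := normc_ge0 z; have s0 := le_trans z0 zs.
apply: le_trans (normc_bool_le _ _) _; rewrite normcX /lac_term.
have L1 : 1 <= (lac j)%:R :> R by rewrite ler1n (leq_ltn_trans _ (lac_gt j)).
apply: le_trans (ler_wpM2r (exprn_ge0 _ s0) L1); rewrite mul1r.
apply: (@le_trans _ _ (s ^+ lac j)); first by rewrite lerXn2r ?nnegrE.
by rewrite ler_wiXn2l// leq_pred.
Qed.

Lemma lac_term_summable (s : R) N : 0 <= s < 1 ->
  \sum_(j < N) lac_term s j <= 2 / (1 - s).
Proof.
move=> /andP[s0 s1]; rewrite ler_pdivlMr ?subr_gt0// mulrC.
by apply: lac_sum_le; rewrite s0 ltW.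
Qed.

Lemma lac_deriv_le A z : normc z < 1 ->
  normc (lac_deriv A z) <= 2 / (1 - normc z).
Proof.
move=> z1; apply: (@csum_le _ _ (lac_term (normc z))) => [j|N].
  exact: lac_deriv_term_le.
by apply: lac_term_summable; rewrite normc_ge0.
Qed.

(** Termwise differentiation: the second-order remainders of the monomials sum to at most a constant
    times |h|^2. *)
Lemma is_derive_lac A (f : C -> C) z : (forall w, normc w < 1 -> f w = lac_fun A w) ->
  normc z < 1 -> is_derive z 1 f (lac_deriv A z).
Proof.
move=> fA z1; have z0 := normc_ge0 z.
(* The remainders are estimated on the disk of radius t^2, where t^2 - |z| = ((1 - |z|)/2)^2 > 0. *)
pose t := (1 + normc z) / 2.
have t0 : 0 < t by rewrite divr_gt0// ltr_wpDr.
have t1 : t < 1 by rewrite /t; lra.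
have zt : normc z < t ^+ 2 by rewrite /t expr2; nra.
have tt1 : t ^+ 2 < 1 by rewrite exprn_ilt1// ltW.
have tt0 : 0 < t ^+ 2 by rewrite exprn_gt0.
have d0 : 0 < t ^+ 2 - normc z by rewrite subr_gt0.
apply: (is_derive_second_order (K := (2 / (1 - t)) ^+ 2 / t ^+ 2) d0) => h hd.
have zht : normc (z + h) <= t ^+ 2.
  by apply: le_trans (normcD _ _) _; rewrite addrC -lerBrDr ltW.
rewrite !fA ?(le_lt_trans zht)//.
have sumF w : normc w <= t ^+ 2 -> csummable (fun j => (A j)%:R * w ^+ lac j).
  move=> wt; apply: (csummable_le (b := lac_term (t ^+ 2))).
    by move=> j; apply: lac_fun_term_le => //; exact: ltW.
  by move=> N; apply: lac_term_summable; rewrite tt1 ltW.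
have sumG : csummable (fun j => (A j)%:R * ((lac j)%:R * z ^+ (lac j).-1)).
  apply: (csummable_le (b := lac_term (t ^+ 2))).
    by move=> j; apply: lac_deriv_term_le; exact: ltW.
  by move=> N; apply: lac_term_summable; rewrite tt1 ltW.
apply: (normc_lim_le (cvgB (cvgB (csum_cvg (sumF _ zht)) (csum_cvg (sumF _ (ltW zt))))
  (cvgM (cvg_cst h) (csum_cvg sumG)))).
apply: nearW => n.
rewrite !fctE !seriesEord /= mulr_sumr -!sumrB.
apply: le_trans (normc_sum _ _ _) _.
rewrite mulrAC ler_pdivlMr// mulrC mulr_sumr.
apply: (@le_trans _ _ (normc h ^+ 2 * (\sum_(j < n) lac_term t j ^+ 2))).
  rewrite mulr_sumr; apply: ler_sum => j _.
  rewrite mulrCA -!mulrBr.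
  apply: le_trans (ler_wpM2l (ltW tt0) (normc_bool_le _ _)) _.
  apply: le_trans (power_second_order (lac j) tt0 (ltW zt) zht) _.
  by rewrite /lac_term [(_ * _) ^+ 2 in leRHS]exprMn [in leRHS]exprAC.
rewrite mulrC ler_wpM2r ?exprn_ge0 ?normc_ge0//.
have sums := @lac_term_summable t n.
have S0 : 0 <= \sum_(j < n) lac_term t j.
  by apply: sumr_ge0 => j _; apply: lac_term_ge0; exact: ltW.
(* A sum of squares of nonnegative numbers is at most the square of their sum. *)
apply: (@le_trans _ _ ((\sum_(j < n) lac_term t j) ^+ 2)); last first.
  rewrite lerXn2r ?nnegrE ?sums ?t1 ?(ltW t0)//.
  by rewrite divr_ge0// subr_ge0 ltW.
rewrite expr2 mulr_suml; apply: ler_sum => j _; rewrite expr2.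
apply: ler_wpM2l; first by apply: lac_term_ge0; exact: ltW.
rewrite (bigD1 j)//= lerDl; apply: sumr_ge0 => i _; apply: lac_term_ge0; exact: ltW.
Qed.

Definition lac_ext A z : C := if `[< unit_disk z >] then lac_fun A z else 0.

Lemma lac_extE A z : normc z < 1 -> lac_ext A z = lac_fun A z.
Proof. by rewrite /lac_ext => z1; case: asboolP. Qed.

Lemma derive1_lac_ext A z : normc z < 1 -> derive1 (lac_ext A) z = lac_deriv A z.
Proof.
move=> z1; rewrite derive1E.
by have [_ ->] := is_derive_lac (@lac_extE A) z1.
Qed.

Fact lac_bloch_subproof A : lac_ext A \in @bloch_pred R.
Proof.
apply/asboolP; split.
- by move=> z z1; have [] := is_derive_lac (@lac_extE A) z1.
(* The constant is the 2 of [lac_deriv_le] times the bound 2 for 1 + |z|. *)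
- exists 4 => _ [z z1 <-]; rewrite derive1_lac_ext//.
  have z1' : 0 < 1 - normc z by rewrite subr_gt0.
  have := lac_deriv_le A z1; rewrite ler_pdivlMr// => h.
  have -> : 1 - normc z ^+ 2 = (1 + normc z) * (1 - normc z) by ring.
  rewrite -mulrA [_ * normc (lac_deriv A z)]mulrC.
  have z0 := normc_ge0 z; have z1l : normc z < 1 := z1.
  have d0 := normc_ge0 (lac_deriv A z).
  have : 0 <= normc (lac_deriv A z) * (1 - normc z) by rewrite mulr_ge0// ltW.
  by nra.
- by move=> z z1; rewrite /lac_ext; case: asboolP.
Qed.

Definition lac_bloch A : bloch R := Bloch (lac_bloch_subproof A).

(* On the circle of radius [1 - lac_gap k] the term of exponent [lac k]
   dominates the derivative of the series. *)
Lemma lac_deriv_circle A z k : normc z = 1 - lac_gap R k ->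
  lac_gap R k * normc (lac_deriv A z - (A k)%:R * ((lac k)%:R * z ^+ (lac k).-1))
  <= 5 / k.+1%:R.
Proof.
move=> zk; have u0 := lac_gap_gt0 R k; rewrite mulrC -ler_pdivlMr//.
apply: (csum_off (b := lac_term (1 - lac_gap R k))) => [j|N].
  by apply: lac_deriv_term_le; rewrite zk.
by rewrite ler_pdivlMr// mulrC; exact: lac_off.
Qed.

(** Controls the undifferentiated factor in the product rule for z^n f. The terms other than the
    [k]-th give 5/(k+1) as for the derivative; the [k]-th has modulus at most 1 and costs
    [lac_gap k]. *)
Lemma lac_fun_circle A z k : normc z = 1 - lac_gap R k ->
  lac_gap R k * normc (lac_fun A z) <= 6 / k.+1%:R.
Proof.
move=> zk; have u0 := lac_gap_gt0 R k; have u1 := lac_gap_le1 R k.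
have -> : lac_fun A z = (lac_fun A z - (A k)%:R * z ^+ lac k) + (A k)%:R * z ^+ lac k.
  by rewrite subrK.
apply: le_trans (ler_wpM2l (ltW u0) (normcD _ _)) _; rewrite mulrDr.
have -> : 6 / k.+1%:R = 5 / k.+1%:R + k.+1%:R^-1 :> R by ring.
apply: lerD.
  rewrite mulrC -ler_pdivlMr//.
  apply: (csum_off (b := lac_term (1 - lac_gap R k))) => [j|N].
    by apply: lac_fun_term_le; rewrite ?zk// gerBl ltW.
  by rewrite ler_pdivlMr// mulrC; exact: lac_off.
apply: le_trans (lac_gap_le R k); rewrite ler_piMr ?(ltW u0)//.
apply: le_trans (normc_bool_le _ _) _; rewrite normcX zk.
by rewrite exprn_ile1 ?subr_ge0// gerBl ltW.
Qed.

End LacunaryFunctions.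

(** * Roots of unity and polynomials on a circle *)

Section RootsOfUnity.
Variable R : realType.
Local Notation C := (Cplx R).

(** Iterated square roots of -1 are primitive roots of unity of order [2 ^ k.+1]. *)
Fixpoint dyadic_root k : C := if k is k'.+1 then sqrtc (dyadic_root k') else -1.

Lemma dyadic_rootS k : dyadic_root k.+1 ^+ 2 = dyadic_root k.
Proof. exact: sqr_sqrtc. Qed.

Lemma dyadic_root_exp k : dyadic_root k ^+ (2 ^ k) = -1.
Proof. by elim: k => // k IHk; rewrite expnS exprM dyadic_rootS. Qed.

Lemma sign_eq1 q : (-1) ^+ q = 1 :> C -> ~~ odd q.
Proof.
rewrite -signr_odd; case: odd => //= /eqP.
by rewrite expr1 eq_sym -addr_eq0 -mulr2n pnatr_eq0.
Qed.

Lemma dyadic_root_order k e : dyadic_root k ^+ e = 1 -> (2 ^ k.+1 %| e)%N.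
Proof.
elim: k e => [|k IHk] e we1; first by rewrite dvdn2; exact: sign_eq1.
have /IHk/dvdnP[q eE] : dyadic_root k ^+ e = 1.
  by rewrite -dyadic_rootS -exprM mulnC exprM we1 expr1n.
move: we1; rewrite eE mulnC exprM dyadic_root_exp => /sign_eq1.
by rewrite -dvdn2 expnSr => q2; rewrite dvdn_pmul2l ?expn_gt0.
Qed.

Lemma normc_dyadic_root k : normc (dyadic_root k) = 1.
Proof.
apply/eqP; rewrite -(@pexpr_eq1 _ _ (2 ^ k)) ?normc_ge0 ?expn_gt0//.
by rewrite -normcX dyadic_root_exp normcN; apply/eqP; exact: (normc_nat R 1).
Qed.

(* The mean over the circle, computed at roots of unity of large order, of the
   polynomial [1 - \sum_i c i * z ^+ e i] is its value [1] at the origin. *)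
Lemma circle_ge1 (r : R) (I : finType) (P : pred I) (c : I -> C) (e : I -> nat) :
  0 <= r -> (forall i, P i -> (0 < e i)%N) ->
  exists2 z : C, normc z = r & 1 <= normc (1 - \sum_(i | P i) c i * z ^+ e i).
Proof.
move=> r0 e0; apply: contrapT => H.
pose k := \max_i e i; pose w := dyadic_root k; pose N := (2 ^ k.+1)%N.
pose z (j : 'I_N) : C := r%:C * w ^+ j.
have zr j : normc (z j) = r.
  rewrite normcMC normcX normc_dyadic_root expr1n mulr1 /=.
  by rewrite expr0n /= addr0 sqrtr_sqr ger0_norm.
pose Q (x : C) := 1 - \sum_(i | P i) c i * x ^+ e i.
have Q1 j : normc (Q (z j)) < 1.
  by rewrite ltNge; apply/negP => Qj; apply: H; exists (z j).
have sum0 i : P i -> \sum_(j < N) z j ^+ e i = 0.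
  move=> /e0 ei0; rewrite /z.
  under eq_bigr do rewrite exprMn -exprM mulnC exprM.
  rewrite -mulr_sumr.
  have w1 : w ^+ e i != 1.
    apply/eqP => /dyadic_root_order /dvdn_leq -/(_ ei0); apply/negP; rewrite -ltnNge.
    apply: (@leq_ltn_trans k); first exact: leq_bigmax.
    by apply: ltn_trans (ltn_expl k.+1 _).
  have : (w ^+ e i - 1) * (\sum_(j < N) (w ^+ e i) ^+ j) = 0.
    rewrite -subrX1 -exprM mulnC exprM /N expnSr exprM dyadic_root_exp.
    by rewrite sqrrN !expr1n subrr.
  by move=> /eqP; rewrite mulf_eq0 subr_eq0 (negbTE w1)/= => /eqP->; rewrite mulr0.
have sumQ : \sum_(j < N) Q (z j) = N%:R.
  rewrite sumrB sumr_const card_ord exchange_big /= [X in _ - X]big1 ?subr0//.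
  by move=> i Pi; rewrite -mulr_sumr sum0// mulr0.
have N0 : (0 < N)%N by rewrite expn_gt0.
suff : (N%:R : R) < N%:R by rewrite ltxx.
rewrite -{1}(normc_nat R N) -sumQ; apply: le_lt_trans (normc_sum _ _ _) _.
have -> : (N%:R : R) = \sum_(j < N) 1 by rewrite sumr_const card_ord.
apply: ltr_sum => //; apply/hasP; exists (Ordinal N0) => //; exact: mem_index_enum.
Qed.

End RootsOfUnity.

(** * An almost disjoint family indexed by the Cantor space *)

Section AlmostDisjoint.
Implicit Types (x y : nat -> bool).

(** The first [n] bits are read in binary after a leading 1, so the code determines the length as
    well as the bits. *)
Fixpoint prefix_code x n : nat :=
  if n is n'.+1 then (prefix_code x n').*2 + x n' else 1.

(** A branch of the binary tree as a set of nodes: distinct branches share only finitely many. *)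
Definition prefixes x : nat -> bool := fun k => `[< exists n, prefix_code x n = k >].

Lemma prefix_code_gt x n : (n < prefix_code x n)%N.
Proof. by elim: n => //= n IHn; rewrite -addnn; lia. Qed.

Lemma prefix_code_inj x y n m : prefix_code x n = prefix_code y m ->
  n = m /\ forall i, (i < n)%N -> x i = y i.
Proof.
elim: n m => [|n IHn] [|m] //=; first by have := prefix_code_gt y m; lia.
  by have := prefix_code_gt x n; lia.
move=> e; have xy : x n = y m.
  by have := congr1 odd e; rewrite !oddD !odd_double !oddb.
have /IHn[nm xyn] : prefix_code x n = prefix_code y m.
  by move: e; rewrite xy => /addIn/double_inj.
rewrite -nm; split=> // i; rewrite ltnS leq_eqVlt => /orP[/eqP->|/xyn//].
by rewrite xy -nm.
Qed.

Lemma prefixes_select x (I : finType) (y : I -> nat -> bool) k0 :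
  exists k, [/\ (k0 <= k)%N, prefixes x k &
    forall i, prefixes (y i) k = `[< y i = x >]].
Proof.
have /choice[d dP] (i : I) : exists d, y i <> x -> y i d <> x d.
  have [->|yx] := pselect (y i = x); first by exists 0%N.
  apply: contrapT => H; apply: yx; apply/funext => d.
  by apply: contrapT => yd; apply: H; exists d.
(* A prefix of this length passes a point of difference between [x] and each [y i] other than [x],
   and its code exceeds [k0]. *)
pose n := (k0 + \max_i (d i).+1)%N.
exists (prefix_code x n); split.
- by rewrite (leq_trans (leq_addr _ _) (ltnW (prefix_code_gt x n))).
- by apply/asboolP; exists n.
move=> i; apply/asboolP/asboolP => [[m]|->]; last by exists n.
move=> /prefix_code_inj[-> yx]; apply: contrapT => /dP; apply; apply: yx.
by apply: leq_trans (leq_addl _ _); exact: leq_bigmax.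
Qed.

End AlmostDisjoint.

(** * Distance from a generator to the span of the others *)

Section Separation.
Variable R : realType.
Local Notation C := (Cplx R).
Implicit Types (f g : bloch R) (t x : nat -> bool).

Lemma bloch_derive_lin (a : C) f g z : unit_disk z ->
  derive1 (a *: f + g : bloch R) z = a * derive1 f z + derive1 g z.
Proof.
move=> z1; case: (blochP f) => df _ _; case: (blochP g) => dg _ _.
rewrite -[bloch_fun _]/(a *: (f : C -> C) + (g : C -> C)).
rewrite derive1D_disk ?derive1Z_disk//.
- exact: df.
- by apply: derivableZ; exact: df.
- exact: dg.
Qed.

Lemma bloch_derive_sum (I : Type) (s : seq I) (c : I -> C) (F : I -> bloch R) z :
  unit_disk z ->
  derive1 (\sum_(i <- s) c i *: F i : bloch R) z = \sum_(i <- s) c i * derive1 (F i) z.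
Proof.
move=> z1; elim: s => [|i s IHs]; last by rewrite !big_cons bloch_derive_lin// IHs.
by rewrite !big_nil derive1E -[bloch_fun 0]/(cst (0 : C)) derive_cst.
Qed.

Lemma iter_shiftE f n z : iter n (@bloch_shift R) f z = z ^+ n * f z.
Proof. by elim: n => [|n IHn]; rewrite ?mul1r//= IHn mulrA -exprS. Qed.

Lemma derive1_iter_shift f n z : unit_disk z ->
  derive1 (iter n (@bloch_shift R) f) z = z ^+ n * derive1 f z + n%:R * (z ^+ n.-1 * f z).
Proof.
move=> z1; elim: n => [|n IHn]; first by rewrite mul1r mul0r addr0.
rewrite iterS -[bloch_fun (bloch_shift _)]/(fun w : C => w * iter n (@bloch_shift R) f w).
case: (blochP (iter n (@bloch_shift R) f)) => df _ _.
rewrite derive1_mulz; last exact: df.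
rewrite IHn iter_shiftE; case: n {IHn df} => [|n] /=.
  by rewrite !mul0r addr0 expr0 expr1 !mul1r.
rewrite -[n.+2%:R]natr1 !exprS; set x := derive1 _ _.
by move: (n.+1%:R : C) (z ^+ n) x (f z) => c y x u; ring.
Qed.

Definition generator (p : nat * (nat -> bool)) : bloch R :=
  iter p.1 (@bloch_shift R) (lac_bloch R (prefixes p.2)).

Lemma bloch_norm_ge f z : unit_disk z ->
  (1 - normc z) * normc (derive1 f z) <= bloch_norm f.
Proof.
move=> z1; apply: (@le_trans _ _ (sup (bloch_values f))); last first.
  by rewrite lerDr normc_ge0.
apply: le_trans (bloch_sup_ub f z1); rewrite ler_wpM2r ?normc_ge0//.
by rewrite lerD2l lerN2 expr2 ler_piMl ?normc_ge0// ltW.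
Qed.

Lemma generator_separated t (n : nat) (c : 'I_n -> C) (p : 'I_n -> nat * (nat -> bool)) :
  (forall i, p i <> (0%N, t)) ->
  8^-1 <= bloch_norm (generator (0%N, t) - \sum_(i < n) c i *: generator (p i)).
Proof.
move=> pt; set g := _ - _.
(* Total error, up to the factor 1/(k+1): 5 for each off-diagonal remainder ([lac_deriv_circle]),
   and 6 times the exponent for the product-rule term ([lac_fun_circle]). The choice of [k0] pushes
   it below 1/8. *)
pose K : R := 5 + \sum_(i < n) normc (c i) * ((p i).1%:R * 6 + 5).
have [k0 Kk0] : exists k0 : nat, 8 * K <= k0%:R.
  exists (Num.bound `|8 * K|).
  exact: le_trans (ler_norm _) (ltW (archi_boundP (normr_ge0 _))).
have [k [k0k tk yk]] := @prefixes_select t _ (fun i => (p i).2) k0.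
set u := lac_gap R k; set r := 1 - u.
have u0 : 0 < u := lac_gap_gt0 R k; have u1 : u <= 1 := lac_gap_le1 R k.
have r0 : 0 <= r by rewrite subr_ge0.
(* Only the generators on the branch [t] keep the term of exponent [lac k]. They differ from
   [(0, t)], so their powers of [z] are positive, as [circle_ge1] requires. *)
have [i /asboolP yit|z zr Qz] := @circle_ge1 R r _ (fun i => `[< (p i).2 = t >]) c
    (fun i => (p i).1) r0.
  by rewrite lt0n; apply/eqP => pi0; apply: (pt i); rewrite -yit -pi0; case: (p i).
move: Qz; set Q := 1 - _ => Qz.
have z1 : unit_disk z by rewrite /unit_disk /= zr gtrBl.
have uE : u = 1 - normc z by rewrite zr /r; ring.
apply: le_trans (bloch_norm_ge g z1); rewrite -uE.
pose L : C := (lac k)%:R * z ^+ (lac k).-1.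
pose D x := lac_deriv (prefixes x) z.
pose rem x := D x - (prefixes x k)%:R * L.
have remP x : u * normc (rem x) <= 5 / k.+1%:R by exact: lac_deriv_circle.
have funP x : u * normc (lac_fun (prefixes x) z) <= 6 / k.+1%:R by exact: lac_fun_circle.
have z1r : normc z <= 1 by exact: ltW.
have dgen q : derive1 (generator q) z =
    z ^+ q.1 * D q.2 + q.1%:R * (z ^+ q.1.-1 * lac_fun (prefixes q.2) z).
  rewrite derive1_iter_shift// -[bloch_fun (lac_bloch _ _)]/(lac_ext (prefixes q.2)).
  by rewrite derive1_lac_ext// lac_extE.
(* The main term collects all contributions of exponent [lac k]; everything else goes to the
   error. *)
have gE : derive1 g z = L * Q + (rem t - \sum_(i < n) c i *
    (z ^+ (p i).1 * rem (p i).2 +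
     (p i).1%:R * (z ^+ (p i).1.-1 * lac_fun (prefixes (p i).2) z))).
  rewrite /g -[X in X - _]scale1r -scaleN1r addrC bloch_derive_lin// bloch_derive_sum//.
  rewrite -[1 *: _]addr0 bloch_derive_lin//.
  have -> : derive1 (0 : bloch R) z = 0.
    by rewrite derive1E -[bloch_fun 0]/(cst (0 : C)) derive_cst.
  rewrite addr0 mul1r mulN1r dgen /= mul1r mul0r addr0 addrC.
  rewrite /Q mulrBr mulr1 mulr_sumr addrACA -opprD.
  congr (_ - _); first by rewrite /rem tk mul1r addrC subrK.
  rewrite [in RHS]big_mkcond -big_split /=; apply: eq_bigr => i _.
  rewrite dgen /rem yk; case: asboolP => _; rewrite ?mul1r ?mul0r ?subr0 ?add0r//.
  by rewrite mulrBr !mulrDr; ring.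
have remB : u * normc (rem t - \sum_(i < n) c i * (z ^+ (p i).1 * rem (p i).2 +
    (p i).1%:R * (z ^+ (p i).1.-1 * lac_fun (prefixes (p i).2) z))) <= K / k.+1%:R.
  apply: le_trans (ler_wpM2l (ltW u0) (normcB _ _)) _; rewrite mulrDr /K mulrDl lerD//.
  apply: le_trans (ler_wpM2l (ltW u0) (normc_sum _ _ _)) _.
  rewrite mulr_sumr mulr_suml; apply: ler_sum => i _.
  rewrite normcMC mulrCA -mulrA ler_wpM2l ?normc_ge0//.
  apply: le_trans (ler_wpM2l (ltW u0) (normcD _ _)) _; rewrite mulrDr [leRHS]mulrDl addrC.
  rewrite !normcMC normc_nat !normcX; apply: lerD.
    rewrite mulrCA -[leRHS]mulrA; apply: ler_wpM2l => //.
    rewrite mulrCA; apply: le_trans (funP (p i).2).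
    by rewrite ler_piMl ?exprn_ile1 ?normc_ge0// mulr_ge0 ?normc_ge0// ltW.
  rewrite mulrCA; apply: le_trans (remP (p i).2).
  by rewrite ler_piMl ?exprn_ile1 ?normc_ge0// mulr_ge0 ?normc_ge0// ltW.
have Kk : K / k.+1%:R <= 8^-1.
  rewrite ler_pdivrMr ?ltr0n// -ler_pdivrMl// invrK; apply: le_trans Kk0 _.
  by rewrite ler_nat (leq_trans k0k).
have LQ : 4^-1 <= u * normc (L * Q).
  apply: le_trans (lac_main R k) _; rewrite ler_wpM2l ?(ltW u0)//.
  rewrite normcMC normcMC normc_nat normcX zr -/(lac_term r k).
  by rewrite ler_peMr//; exact: lac_term_ge0.
rewrite gE; set e := rem t - _ in remB *.
have : normc (L * Q) <= normc (L * Q + e) + normc e.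
  by rewrite -{1}[L * Q](addrK e); exact: normcB.
rewrite -(ler_pM2l u0) [u * (_ + _)]mulrDr => LQe.
have half (a b : R) : 4^-1 <= a + b -> b <= 8^-1 -> 8^-1 <= a by lra.
exact: half (le_trans LQ LQe) (le_trans remB Kk).
Qed.

End Separation.

(** * Closed linear spans in a normed space *)

Section ClosedSpan.
Variables (K : numFieldType) (V : normedModType K).
Implicit Types (S : set V) (A : set V).

Lemma linear_span_submod S : submod_closed [pred v | `[< linear_span S v >]].
Proof.
split.
  by apply/asboolP; exists 0%N, (fun=> 0), (fun=> 0); rewrite big_ord0; split=> // -[].
move=> a u v /asboolP[n [c [s [sS ->]]]] /asboolP[m [d [r [rS ->]]]]; apply/asboolP.
exists (n + m)%N,
  (fun i : 'I_(n + m) =>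
     match fintype.split i with inl j => a * c j | inr j => d j end),
  (fun i : 'I_(n + m) => match fintype.split i with inl j => s j | inr j => r j end); split.
  by move=> i; case: fintype.split.
rewrite big_split_ord scaler_sumr /=; congr (_ + _); apply: eq_bigr => i _.
  by rewrite (unsplitK (inl i : 'I_n + 'I_m)) scalerA.
by rewrite (unsplitK (inr i : 'I_n + 'I_m)).
Qed.

Lemma sub_linear_span S : S `<=` linear_span S.
Proof. by move=> v Sv; exists 1%N, (fun=> 1), (fun=> v); rewrite big_ord1 scale1r. Qed.

Lemma closure_normP A v :
  closure A v <-> forall e : K, 0 < e -> exists2 u, A u & `|v - u| < e.
Proof.
split=> [clA e e0|H B /nbhs_normP[e /= e0 eB]].
  have /clA[u [Au uB]] : nbhs v [set u | `|v - u| < e] by apply/nbhs_normP; exists e.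
  by exists u.
by have [u Au vu] := H e e0; exists u; split=> //; exact: eB.
Qed.

Definition closed_span S : {pred V} := [pred v | `[< closure (linear_span S) v >]].

Lemma closed_spanP S v :
  v \in closed_span S <-> forall e : K, 0 < e -> exists2 u, linear_span S u & `|v - u| < e.
Proof. by rewrite -closure_normP; split=> [/asboolP|h]//; exact/asboolP. Qed.

Fact closed_span_submod S : submod_closed (closed_span S).
Proof.
have [span0 spanD] := linear_span_submod S.
split.
  apply/closed_spanP => e e0; exists 0; last by rewrite subrr normr0.
  exact/asboolP.
move=> a u v /closed_spanP uS /closed_spanP vS; apply/closed_spanP => e e0.
have a1 : 0 < `|a| + 1 by rewrite ltr_wpDl.
have [u' u'S uu'] := uS (e / 2 / (`|a| + 1)) (divr_gt0 (divr_gt0 e0 (ltr0Sn _ _)) a1).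
have [v' v'S vv'] := vS (e / 2) (divr_gt0 e0 (ltr0Sn _ _)).
exists (a *: u' + v'); first by apply/asboolP; apply: spanD; exact/asboolP.
rewrite opprD addrACA -scalerBr; apply: le_lt_trans (ler_normD _ _) _.
rewrite [ltRHS]splitr ler_ltD// normrZ; apply: (@le_trans _ _ ((`|a| + 1) * `|u - u'|)).
  by rewrite ler_wpM2r// lerDl.
by rewrite mulrC -ler_pdivlMr// ltW.
Qed.

HB.instance Definition _ S :=
  GRing.isSubmodClosed.Build K V (closed_span S) (closed_span_submod S).

Lemma closed_closed_span S : closed [set v | v \in closed_span S].
Proof.
have -> : [set v | v \in closed_span S] = closure (linear_span S).
  by apply/seteqP; split=> v /asboolP.
exact: closed_closure.
Qed.

Lemma closed_span_incl S v : S v -> v \in closed_span S.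
Proof. by move=> Sv; apply/asboolP; apply: subset_closure; exact: sub_linear_span. Qed.

Lemma closed_span_mono S S' : S `<=` S' -> {subset closed_span S <= closed_span S'}.
Proof.
move=> SS' v /asboolP clv; apply/asboolP; move: v clv; apply: closure_subset.
by move=> v [n [c [s [sS ->]]]]; exists n, c, s; split=> // i; exact: SS'.
Qed.

End ClosedSpan.

(** * The invariant subspace and its subspaces omitting one generator *)

Section InvariantSubspace.
Variable R : realType.
Local Notation C := (Cplx R).
Local Notation T := (nat -> bool).
Implicit Types (f g h : bloch R) (t : T).

Definition gens (P : set (nat * T)) : set (bloch R) := @generator R @` P.

Definition full_span := closed_span (gens setT).

(* It plays the role of the kernel of a functional equal to [1] at the generator of
   index [t] and to [0] at the other ones. *)
Definition hyper_span t := closed_span (gens [set p | p <> (0%N, t)]).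

Lemma blochB_norm f g : bloch_norm (f - g) <= bloch_norm f + bloch_norm g.
Proof. by have := ler_normB f g; rewrite !bloch_normE -rmorphD lecR. Qed.

Lemma bloch_distC f g : bloch_norm (f - g) = bloch_norm (g - f).
Proof. by have := distrC f g; rewrite !bloch_normE => /complexI. Qed.

(** In (zf)' = z f' + f the first summand costs the seminorm of [f] and the second, by the growth
    estimate, the full norm. This continuity carries shift invariance from a span to its closure. *)
Lemma bloch_norm_shift f : bloch_norm (bloch_shift f) <= 2 * bloch_norm f.
Proof.
rewrite /bloch_norm [bloch_shift f 0]mul0r normc0C add0r; apply: bloch_sup_le => z z1.
case: (blochP f) => df _ _; have wz := ltW (weight_ge0 z1).
rewrite -[bloch_fun (bloch_shift f)]/(fun w : C => w * f w) derive1_mulz; last exact: df.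
have supM : ubound (bloch_values f) (sup (bloch_values f)).
  by apply: sup_upper_bound; exact: bloch_has_sup.
apply: le_trans (ler_wpM2l wz (normcD _ _)) _; rewrite mulrDr.
have h1 : (1 - normc z ^+ 2) * normc (z * derive1 f z) <= sup (bloch_values f).
  apply: le_trans (bloch_sup_ub f z1); rewrite ler_wpM2l// normcMC.
  by rewrite ler_piMl ?normc_ge0// ltW.
have h2 : (1 - normc z ^+ 2) * normc (f z) <= normc (f 0) + sup (bloch_values f).
  have -> : f z = f 0 + (f z - f 0) by rewrite addrCA subrr addr0.
  apply: le_trans (ler_wpM2l wz (normcD _ _)) _; rewrite mulrDr lerD//.
    by rewrite ler_piMl ?normc_ge0// gerBl exprn_ge0 ?normc_ge0.
  exact: bloch_growth.
have := normc_ge0 (f 0); have := lerD h1 h2.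
move: (_ + _) => x; move: (normc (f 0)) (sup _) => y s; lra.
Qed.

Lemma closed_span_blochP S f : f \in closed_span S <->
  forall e : R, 0 < e -> exists2 g, linear_span S g & bloch_norm (f - g) < e.
Proof.
rewrite closed_spanP; split=> H e e0.
  have e0' : (0 : C) < e%:C by rewrite ltcR.
  by have [g gS] := H _ e0'; rewrite bloch_normE ltcR => fg; exists g.
have re0 : 0 < complex.Re e by move: e0; rewrite ltcE => /andP[].
have eE : e = (complex.Re e)%:C by rewrite RRe_real// gtr0_real.
by have [g gS fg] := H _ re0; exists g => //; rewrite bloch_normE eE ltcR.
Qed.

(** Shifting a generator raises its power of [z], so the result is never the generator [(0, t)]. *)
Lemma shift_full_hyper t f : f \in full_span -> bloch_shift f \in hyper_span t.
Proof.
move=> /closed_span_blochP fE; apply/closed_span_blochP => e e0.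
have [_ [n [c [s [sS ->]]]] fg] := fE (e / 2) (divr_gt0 e0 (ltr0Sn _ _)).
exists (bloch_shift (\sum_(i < n) c i *: s i)).
  exists n, c, (fun i => bloch_shift (s i)); split.
    by move=> i; have [[m x] _ <-] := sS i; exists (m.+1, x).
  apply: (big_ind2 (fun u v => bloch_shift u = v)) => //.
  - by apply: bloch_ext => z; rewrite /= mulr0.
  - by move=> u u' v v' <- <-; rewrite bloch_shiftD.
  - by move=> i _; rewrite bloch_shiftZ.
rewrite -scaleN1r -bloch_shiftZ -bloch_shiftD scaleN1r.
by apply: le_lt_trans (bloch_norm_shift _) _; rewrite mulrC -ltr_pdivlMr.
Qed.

Lemma hyper_full t : {subset hyper_span t <= full_span}.
Proof. by apply: closed_span_mono; exact: image_subset. Qed.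

Lemma shift_full f : f \in full_span -> bloch_shift f \in full_span.
Proof. by move=> fE; apply: (@hyper_full (fun=> true)); exact: shift_full_hyper. Qed.

Lemma generator_dist t h : h \in hyper_span t ->
  8^-1 <= bloch_norm (generator R (0%N, t) - h).
Proof.
move=> /closed_span_blochP hH; apply/ler_addgt0Pr => e e0.
have [_ [n [c [s [sS ->]]]] hd] := hH e e0.
have /choice[p pP] i : exists p, p <> (0%N, t) /\ generator R p = s i.
  by have [p pt ps] := sS i; exists p.
have sE : \sum_(i < n) c i *: s i = \sum_(i < n) c i *: generator R (p i).
  by apply: eq_bigr => i _; case: (pP i) => _ ->.
apply: le_trans (generator_separated c (fun i => (pP i).1)) _; rewrite -sE.
set d := \sum_(i < n) _ in hd *.
have -> : generator R (0%N, t) - d = (generator R (0%N, t) - h) - (d - h).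
  by rewrite opprB addrA subrK.
apply: le_trans (blochB_norm _ _) _; rewrite lerD2l bloch_distC.
exact: ltW.
Qed.

(** The list holds the branches occurring in one combination. Reading it with [nth] also excludes
    the default [point], which only adds one more index. *)
Lemma span_finite_support g : linear_span (gens setT) g ->
  exists x : seq T, forall t, (forall i, nth point x i <> t) ->
    linear_span (gens [set p | p <> (0%N, t)]) g.
Proof.
move=> [n [c [s [sS ->]]]].
have /choice[p pP] i : exists p, generator R p = s i by have [p _ ps] := sS i; exists p.
exists [seq (p i).2 | i <- enum 'I_n] => t xt; exists n, c, s; split=> // i.
exists (p i) => //= pit; apply: (xt i).
by rewrite (nth_map i) ?size_enum_ord// nth_ord_enum pit.
Qed.

(** Approximants within 1/(n+1) of [g] involve countably many branches altogether. For any other [t]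
    they all avoid the generator [(0, t)], so [g] is in [hyper_span t]. *)
Lemma full_countable_support g : g \in full_span ->
  exists x : nat -> T, forall t, g \notin hyper_span t -> exists k, x k = t.
Proof.
move=> /closed_span_blochP gE.
have /choice[x xP] n : exists x : seq T, forall t, (forall i, nth point x i <> t) ->
    exists2 d, linear_span (gens [set p | p <> (0%N, t)]) d &
      bloch_norm (g - d) < n.+1%:R^-1.
  have n0 : 0 < n.+1%:R^-1 :> R by rewrite invr_gt0.
  have [d dS gd] := gE _ n0; have [x xP] := span_finite_support dS.
  by exists x => t /xP dt; exists d.
(* The finite lists are merged into one sequence through a coding of pairs. *)
exists (fun k => if unpickle k is Some p then nth point (x p.1) p.2 else point) => t.
move=> /negP gH; apply: contrapT => H; apply: gH.
apply/closed_span_blochP => e e0.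
have [n ne] : exists n : nat, n.+1%:R^-1 < e.
  exists (Num.bound e^-1); rewrite invf_plt ?posrE//.
  apply: lt_trans (archi_boundP _) _; rewrite ?invr_ge0 ?ltW// ltr_nat//.
have [|d dS gd] := xP n t; last by exists d => //; exact: lt_trans ne.
by move=> i it; apply: H; exists (pickle (n, i)); rewrite pickleK.
Qed.

End InvariantSubspace.

(** * Cardinality of the continuum *)

Section Continuum.
Local Notation T := (nat -> bool).

(* Koenig's diagonal argument: if no column of [e] were onto, the columns could
   be avoided simultaneously. *)
Lemma countable_fibers_surj (Q : Type) (S : set Q) (e : Q -> nat -> T) :
  (forall t, exists2 s, S s & exists k, e s k = t) ->
  exists phi : Q -> T, forall t, exists2 s, S s & phi s = t.
Proof.
move=> eS; pose column (k : nat) (t : T) : T := fun m : nat => t (pickle (k, m)).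
apply: contrapT => H.
have /choice[a aP] k : exists a : T, forall s, S s -> column k (e s k) <> a.
  apply: contrapT => Hk; apply: H; exists (fun s => column k (e s k)) => t.
  by apply: contrapT => Ht; apply: Hk; exists t => s Ss st; apply: Ht; exists s.
have [s Ss [k ek]] := eS (fun i => if unpickle i is Some p then a p.1 p.2 else false).
apply: (aP k s Ss); rewrite ek; apply/funext => m.
by rewrite /column pickleK.
Qed.

Variable R : realType.

(** A real is determined by its Dedekind cut, a set of rationals. *)
Lemma card_unit_interval_le_cantor : [set x : R | 0 <= x <= 1] #<= [set: T].
Proof.
pose cut (x : R) : T := fun n => if unpickle n is Some q then ratr q < x else false.
apply/pcard_injP; exists cut => x y _ _.
wlog xy : x y / x < y.
  by move=> H e; have [/H->//|/H<-//|//] := ltgtP x y.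
have [q] := rat_in_itvoo xy; rewrite in_itv/= => /andP[xq qy].
move=> /(congr1 (fun f => f (pickle q))).
by rewrite /cut pickleK qy ltNge (ltW xq).
Qed.

Definition ternary_sum (b : T) n : R := \sum_(i < n) (b i)%:R * 3^-1 ^+ i.+1.

(** Base 3 with digits 0 and 1 makes expansions unique; the partial sums increase, so the supremum
    is their limit. *)
Definition ternary (b : T) : R := sup (range (ternary_sum b)).

Lemma ternary_sumS b n : ternary_sum b n.+1 = ternary_sum b n + (b n)%:R * 3^-1 ^+ n.+1.
Proof. by rewrite /ternary_sum big_ord_recr. Qed.

Lemma ternary_sum_le b n m :
  ternary_sum b m <= ternary_sum b n + 2^-1 * 3^-1 ^+ n.
Proof.
have p0 k : 0 <= 3^-1 ^+ k :> R by rewrite exprn_ge0// invr_ge0.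
have [mn|/ltnW nm] := leqP m n.
  apply: (@le_trans _ _ (ternary_sum b n)); last by rewrite lerDl mulr_ge0.
  rewrite -(subnK mn); elim: (n - m)%N => // k IHk.
  by rewrite addSn ternary_sumS; apply: le_trans IHk _; rewrite lerDl mulr_ge0.
(* A partial sum plus the largest possible tail is nonincreasing in its length. *)
suff : ternary_sum b m + 2^-1 * 3^-1 ^+ m <= ternary_sum b n + 2^-1 * 3^-1 ^+ n.
  by apply: le_trans; rewrite lerDl mulr_ge0.
rewrite -(subnK nm); elim: (m - n)%N => // k IHk; apply: le_trans IHk.
rewrite addSn ternary_sumS exprS; have := p0 (k + n)%N; set x := 3^-1 ^+ _.
by case: (b _); rewrite ?mul1r ?mul0r; lra.
Qed.

Lemma ternary_bounds b n :
  ternary_sum b n <= ternary b <= ternary_sum b n + 2^-1 * 3^-1 ^+ n.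
Proof.
apply/andP; split.
  apply: ub_le_sup; last by exists n.
  by exists (ternary_sum b 0 + 2^-1 * 3^-1 ^+ 0) => _ [m _ <-]; exact: ternary_sum_le.
apply: ge_sup; first by exists (ternary_sum b 0), 0%N.
by move=> _ [m _ <-]; exact: ternary_sum_le.
Qed.

(** At the first differing digit the partial sums are 3^-(n+1) apart, while a tail is at most half
    of that. *)
Lemma ternary_inj : injective ternary.
Proof.
move=> b c bc; apply/funext => n; elim/ltn_ind: n => n IHn.
have sumE : ternary_sum b n = ternary_sum c n.
  by apply: eq_bigr => i _; rewrite IHn.
have p0 : 0 < 3^-1 ^+ n.+1 :> R by rewrite exprn_gt0// invr_gt0.
have := ternary_bounds b n.+1; have := ternary_bounds c n.+1.
rewrite !ternary_sumS sumE bc; set x := 3^-1 ^+ _ in p0 *.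
by case: (b n); case: (c n) => //=; rewrite mul1r mul0r; lra.
Qed.

Lemma card_cantor_le_unit_interval : [set: T] #<= [set x : R | 0 <= x <= 1].
Proof.
rewrite -(card_le_eql (inj_card_eq (in2W ternary_inj))); apply: subset_card_le.
move=> _ [b _ <-] /=; have := ternary_bounds b 0.
by rewrite /ternary_sum big_ord0 expr0; lra.
Qed.

End Continuum.

(** * The index of the subspace *)

Section Index.
Variable R : realType.
Local Notation C := (Cplx R).
Local Notation T := (nat -> bool).

Definition full_submod : submodClosed (bloch R) := closed_span (gens (R := R) setT).

Local Notation E := full_submod.
Local Notation pi := (@lquot_pi _ _ (@shift_image R E)).

Fact generator_full p : generator R p \in E.
Proof. by apply: closed_span_incl; exists p. Qed.

Definition gen_full p : submod E := Submod (generator_full p).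

Lemma submod_val_sum n (c : 'I_n -> C) (F : 'I_n -> submod E) :
  submod_val (\sum_(i < n) c i *: F i) = \sum_(i < n) c i *: submod_val (F i).
Proof. by apply: (big_ind2 (fun u v => submod_val u = v)) => // u u' v v' <- <-. Qed.

Lemma pi_sum n (c : 'I_n -> C) (F : 'I_n -> submod E) :
  pi (\sum_(i < n) c i *: F i) = \sum_(i < n) c i *: pi (F i).
Proof.
apply: (big_ind2 (fun u v => pi u = v)) => //.
  by apply: (addIr (pi 0)); rewrite -lquot_piD !add0r.
- by move=> u u' v v' <- <-; rewrite lquot_piD.
- by move=> i _; rewrite lquot_piZ.
Qed.

Lemma pi_sub f g : pi (f - g) = pi f - pi g.
Proof. by rewrite lquot_piD -scaleN1r lquot_piZ scaleN1r. Qed.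

Lemma quot_norm_le f : quot_norm (pi f) <= bloch_norm (submod_val f).
Proof.
apply: ge_inf; last by exists f.
by exists 0 => _ [g _ <-]; rewrite addr_ge0 ?normc_ge0 ?bloch_sup_ge0.
Qed.

Lemma pi_gen n t : pi (gen_full (n.+1, t)) = 0.
Proof.
rewrite -[RHS](subrr (pi 0)) -pi_sub subrr; apply/lquot_piP; rewrite subr0.
by apply/asboolP; exists (generator R (n, t)) => //; exact: generator_full.
Qed.

Definition gen_classes : set (shift_quot E) := range (fun t => pi (gen_full (0%N, t))).

Lemma gen_classes_dense : dense_span gen_classes.
Proof.
move=> q e e0; rewrite -(lquot_reprK q); set f := repr q.
have /closed_span_blochP/(_ e e0)[_ [n [c [s [sS ->]]]] fs] : submod_val f \in E.
  by case: f.
have /choice[p pP] i : exists p, generator R p = s i by have [p _ ps] := sS i; exists p.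
(* Generators with a positive power of [z] lie in zE and vanish in the quotient, so their
   coefficients are set to 0. *)
exists (\sum_(i < n) (if (p i).1 == 0%N then c i else 0) *: pi (gen_full (0%N, (p i).2))).
  by exists n, (fun i => if (p i).1 == 0%N then c i else 0),
    (fun i => pi (gen_full (0%N, (p i).2))); split=> // i; exists (p i).2.
have -> : \sum_(i < n) (if (p i).1 == 0%N then c i else 0) *: pi (gen_full (0%N, (p i).2))
    = pi (\sum_(i < n) c i *: gen_full (p i)).
  rewrite pi_sum; apply: eq_bigr => i _.
  by case: (p i) => [[|m] t] //=; rewrite pi_gen scaler0 scale0r.
rewrite -pi_sub; apply: le_lt_trans (quot_norm_le _) _.
rewrite -[submod_val _]/(submod_val f - submod_val _) submod_val_sum.
by under eq_bigr do rewrite /= pP.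
Qed.

(** Since zE is contained in [hyper_span t], the choice of representatives is immaterial. If all of
    them were in [hyper_span t], the span of [S] would stay at distance at least 1/8 from the class
    of the generator [(0, t)]. *)
Lemma dense_span_detects S t : dense_span S ->
  exists2 q : shift_quot E, S q & submod_val (repr q) \notin hyper_span t.
Proof.
move=> Sdense; apply: contrapT => H.
have SH q : S q -> submod_val (repr q) \in hyper_span t.
  by move=> Sq; apply: contrapT => /negP qH; apply: H; exists q.
have e0 : 0 < 8^-1 :> R by rewrite invr_gt0.
have [_ [n [c [s [sS ->]]]] qs] := Sdense (pi (gen_full (0%N, t))) _ e0.
pose h : submod E := \sum_(i < n) c i *: repr (s i).
have hH : submod_val h \in hyper_span t.
  by rewrite submod_val_sum; apply: rpred_sum => i _; apply: rpredZ; exact: SH.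
have hE : pi h = \sum_(i < n) c i *: s i.
  by rewrite pi_sum; apply: eq_bigr => i _; rewrite lquot_reprK.
move: qs; rewrite -hE -pi_sub => /inf_lt[].
  by exists (bloch_norm (submod_val (gen_full (0%N, t) - h))), (gen_full (0%N, t) - h).
move=> _ [g /lquot_piP/asboolP[f fE gf] <-].
apply/negP; rewrite -leNgt.
(* Any representative of the difference of classes is the generator minus an element of
   [hyper_span t]. *)
have -> : submod_val g = generator R (0%N, t) - (submod_val h - bloch_shift f).
  rewrite opprB addrCA -gf.
  set x := generator R _.
  by rewrite -[submod_val (g - _)]/(submod_val g - (x - submod_val h)) subrK.
by apply: generator_dist; rewrite rpredB// shift_full_hyper.
Qed.

(** Every [t] is detected by some element of [S], and each element detects only countably many [t];
    [countable_fibers_surj] then maps [S] onto the Cantor space, and a section of that map is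
    injective. *)
Lemma dense_span_card (S : set (shift_quot E)) :
  dense_span S -> [set x : R | 0 <= x <= 1] #<= S.
Proof.
move=> Sdense.
have /choice[x xP] (q : shift_quot E) : exists x : nat -> T,
    forall t, submod_val (repr q) \notin hyper_span t -> exists k, x k = t.
  by apply: full_countable_support; case: (repr q).
have [t|phi phiP] := @countable_fibers_surj _ S x.
  by have [q Sq /xP qt] := dense_span_detects t Sdense; exists q.
have /choice[psi psiP] t : exists q, S q /\ phi q = t.
  by have [q] := phiP t; exists q.
apply: card_le_trans (card_unit_interval_le_cantor R) _.
have psi_inj : injective psi by move=> t u e; rewrite -(psiP t).2 e (psiP u).2.
rewrite -(card_le_eql (inj_card_eq (in2W psi_inj))); apply: subset_card_le.
by move=> _ [t _ <-]; exact: (psiP t).1.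
Qed.

End Index.

Theorem theorem1p4 (R : realType) :
  exists E : submodClosed (bloch R),
    [/\ closed [set f : bloch R | f \in E],
        (forall f : bloch R, f \in E -> bloch_shift f \in E) &
        index_eq_card E [set x : R | 0 <= x <= 1] ].
Proof.
exists (full_submod R); split.
- exact: closed_closed_span.
- exact: shift_full.
- split; last exact: dense_span_card.
  exists (@gen_classes R); split; first exact: gen_classes_dense.
  (* The lower bound for [gen_classes] is the general one for dense spans; the upper bound holds for
     any image of the Cantor space. *)
  rewrite card_eq_le dense_span_card ?andbT; last exact: gen_classes_dense.
  apply: card_le_trans (card_image_le _ _) _.
  exact: card_cantor_le_unit_interval.
Qed.
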